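(* Let $n\ge5$, let $p\ge3$ be odd, and let $\boldsymbol\lambda\in K_n$ be such that $G_{\boldsymbol\lambda}$ is isomorphic to the dihedral group $D_p$ of order $2p$. According to the type of $\boldsymbol\lambda$, its multiplicity vector (a vector of length $\frac{p+3}{2}$) is: 1. type mC: $(2m-1,\,m,\,m-1)$ for $p=3$; $(2m-1,\,2m,\dots,2m,\,m,\,m-1)$ for $p\ge5$; 2. type A+mC: $(2m,\,m,\,m)$ for $p=3$; $(2m,\,2m+1,\dots,2m+1,\,m,\,m)$ for $p\ge5$; 3. type AB+mC: $(2m+1,\,m,\,m+1)$ for $p=3$; $(2m+1,\,2m+2,\dots,2m+2,\,m,\,m+1)$ for $p\ge5$; 4. type 2+mC: $(2m,\dots,2m,\,m,\,m-1)$; 5. type A+2+mC: $(2m+1,\dots,2m+1,\,m,\,m)$; 6. type AB+2+mC: $(2m+2,\dots,2m+2,\,m,\,m+1)$.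
   Context: $K_n=\{\boldsymbol\lambda=(\lambda^1,\dots,\lambda^{n-3})\in\mathbb{C}^{n-3}\mid \lambda^i\neq 0,1,\ \lambda^i\neq\lambda^j \text{ for } i\neq j\}$. For $\boldsymbol\lambda\in K_n$ put $z^{\boldsymbol\lambda}_1=0$, $z^{\boldsymbol\lambda}_2=1$, $z^{\boldsymbol\lambda}_3=\infty$, $z^{\boldsymbol\lambda}_{i+3}=\lambda^i$, and $[\boldsymbol\lambda]=\{z^{\boldsymbol\lambda}_1,\dots,z^{\boldsymbol\lambda}_n\}\subset\widehat{\mathbb{C}}$. For $\sigma\in S_n$, $f^{\boldsymbol\lambda}_\sigma$ is the unique linear fractional transformation (LFT) sending $z^{\boldsymbol\lambda}_{\sigma^{-1}(1)},z^{\boldsymbol\lambda}_{\sigma^{-1}(2)},z^{\boldsymbol\lambda}_{\sigma^{-1}(3)}$ to $0,1,\infty$, and $g_\sigma:K_n\to K_n$, $g_\sigma(\boldsymbol\lambda)=(f^{\boldsymbol\lambda}_\sigma(z^{\boldsymbol\lambda}_{\sigma^{-1}(4)}),\dots,f^{\boldsymbol\lambda}_\sigma(z^{\boldsymbol\lambda}_{\sigma^{-1}(n)}))$. $G=\{g_\sigma\}$ is a group under composition ($g_\pi g_\sigma=g_{\pi\sigma}$; for $n\ge5$, $\sigma\mapsto g_\sigma$ is injective), $G_{\boldsymbol\lambda}$ is the stabilizer of $\boldsymbol\lambda$ in $G$, $\mathcal{A}_{\alpha}$ is the group of LFTs preserving a set $\alpha$, and $\Phi_{\boldsymbol\lambda}:G_{\boldsymbol\lambda}\to\mathcal{A}_{[\boldsymbol\lambda]}$,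 $g_\sigma\mapsto f^{\boldsymbol\lambda}_\sigma$, is a group isomorphism. $X_{\boldsymbol\lambda}:G_{\boldsymbol\lambda}\to \mathrm{GL}_{n-3}(\mathbb{C})$ is the representation sending $g_\sigma$ to the Jacobian matrix of $g_\sigma$ at $\boldsymbol\lambda$. Types. Two subsets of $\widehat{\mathbb{C}}$ are equivalent if an LFT carries one onto the other. Put $A_p=\{e^{\frac{k}{p}2\pi i}\mid k\in\mathbb{Z}\}$, $B_p=\{e^{\frac{2k+1}{2p}2\pi i}\mid k\in\mathbb{Z}\}$, $C_p(z)=\{ze^{\frac kp2\pi i}\mid k\in\mathbb{Z}\}\cup\{z^{-1}e^{\frac kp2\pi i}\mid k\in\mathbb{Z}\}$ for $z\in\mathbb{C}^*\setminus\{e^{\frac{l}{2p}2\pi i}\mid l\in\mathbb{Z}\}$ (orbits of $\langle z\mapsto e^{2\pi i/p}z,z\mapsto 1/z\rangle$; $C_p(z)$ has order $2p$). Let $C=C_p(a_1)\cup\cdots\cup C_p(a_m)$ be a union of $m$ distinct such orbits. $\boldsymbol\lambda$ is of type mC ($m\ge1$), A+mC ($m\ge0$), AB+mC ($m\ge1$), 2+mC ($m\ge1$), A+2+mC ($m\ge0$), AB+2+mC ($m\ge1$) if $[\boldsymbol\lambda]$ is equivalent to a set of the form $C$; $A_p\cup C$; $A_p\cup B_p\cup C$; $\{0,\infty\}\cup C$; $A_p\cup\{0,\infty\}\cup C$; $A_p\cup B_p\cup\{0,\infty\}\cup C$, respectively. Multiplicity vector. For $p$ odd, $G_{\boldsymbol\lambda}\simeq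 D_p$ has $\frac{p+3}2$ conjugacy classes: for $1\le l\le\frac{p-1}2$, $K^{(l)}$ consists of the elements whose images under $\Phi_{\boldsymbol\lambda}$ are conjugate (in the group of LFTs) to a rotation of $\frac{2l\pi}{p}$; $K^{(\frac{p+1}2)}$ is the identity; $K^{(\frac{p+3}2)}$ consists of the elements of order two. The irreducible representations $X^{(1)},\dots,X^{(\frac{p+3}2)}$ are ordered as follows: for $1\le l\le\frac{p-1}{2}$, $X^{(l)}$ is two-dimensional with character $2\cos\frac{2kl\pi}{p}$ on $K^{(k)}$ ($1\le k\le\frac{p-1}2$) and $0$ on elements of order two; $X^{(\frac{p+1}2)}$ is trivial; $X^{(\frac{p+3}2)}$ is one-dimensional, equal to $1$ on all classes except $-1$ on elements of order two. If $X_{\boldsymbol\lambda}\cong\bigoplus_j a_jX^{(j)}$, the multiplicity vector of $\boldsymbol\lambda$ is $(a_1,\dots,a_{\frac{p+3}2})$. *)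

(* Defs.v *)
(* The complex numbers are R[i], for R : realType. *)
From mathcomp Require Import all_boot all_order all_algebra fingroup perm.
From mathcomp Require extremal.
From mathcomp Require Import boolp classical_sets functions reals.
From mathcomp Require Import topology normedtype derive trigo.
From mathcomp Require Export complex.

Set Implicit Arguments.
Unset Strict Implicit.
Unset Printing Implicit Defensive.

Import GRing.Theory Num.Theory numFieldNormedType.Exports.

Local Open Scope classical_set_scope.
Local Open Scope ring_scope.

(* The Riemann sphere; None is the point at infinity. *)
Notation sphere R := (option R[i]).

Section Sphere.
Variable R : realType.
Implicit Types (f h : sphere R -> sphere R) (S T : set (sphere R)).

Definition lft (a b c d : R[i]) (z : sphere R) : sphere R :=
  match z with
  | Some z => if c * z + d == 0 then None else Some ((a * z + b) / (c * z + d))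
  | None => if c == 0 then None else Some (a / c)
  end.

Definition is_lft f :=
  exists a b c d : R[i], a * d - b * c != 0 /\ f = lft a b c d.

(* The unique LFT sending u, v, w to 0, 1, oo; only meaningful when u, v, w
   are pairwise distinct. *)
Definition lft_to_01oo (u v w : sphere R) : sphere R -> sphere R :=
  get [set f : sphere R -> sphere R | is_lft f /\ [/\ f u = Some 0, f v = Some 1 & f w = None]].

Definition cis (t : R) : R[i] := (cos t +i* sin t)%C.

Definition rotation (t : R) (z : sphere R) : sphere R :=
  omap (fun x => cis t * x) z.

Definition lft_conj f1 f2 := exists2 h, is_lft h & h \o f1 = f2 \o h.

Definition sphere_equiv S T := exists2 h, is_lft h & h @` S = T.

End Sphere.

Section Configurations.
Variables (R : realType) (d : nat).
(* Throughout d = n - 3, so that permutations of n = 3 + d points are considered. *)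
Notation E := 'rV[R[i]]_d.
Implicit Types (s : 'S_(3 + d)) (lam : E) (g : E -> E).

Definition Kn : set E :=
  [set lam | (forall i, lam 0 i != 0 /\ lam 0 i != 1) /\
             (forall i j, i != j -> lam 0 i != lam 0 j)].

(* Indices are 0-based: zpt lam 0, 1, 2 are 0, 1, oo and zpt lam (3 + k) is
   the k-th coordinate of lam. *)
Definition zpt lam (i : 'I_(3 + d)) : sphere R :=
  match fintype.split i with
  | inl j => if val j == 0%N then Some 0 else if val j == 1%N then Some 1 else None
  | inr k => Some (lam 0 k)
  end.

Definition config lam : set (sphere R) := range (zpt lam).

Definition fmap s lam : sphere R -> sphere R :=
  let w (k : 'I_3) := zpt lam ((s^-1)%g (lshift d k)) in
  lft_to_01oo (w (@Ordinal 3 0 isT)) (w (@Ordinal 3 1 isT)) (w (@Ordinal 3 2 isT)).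

(* g_s is a self-map of Kn; it is extended to the whole space by the identity,
   so that equality, composition and the neutral element of the self-maps of Kn
   are those of functions E -> E.  The values taken by fmap s lam below are
   finite for lam in Kn, hence the default 0 is not used. *)
Definition gmap s : E -> E :=
  patch id Kn (fun lam =>
    \row_(k < d) odflt 0 (fmap s lam (zpt lam ((s^-1)%g (rshift 3 k))))).

Definition stab lam : set (E -> E) :=
  [set g | (exists s, g = gmap s) /\ g lam = lam].

Definition stab_dihedral (p : nat) lam :=
  exists phi : extremal.dihedral_gtype p.*2 -> (E -> E),
    [/\ injective phi, range phi = stab lam &
        forall x y, phi (x * y)%g = phi x \o phi y].

(* The library's jacobian acts on row vectors; its transpose is the usual
   matrix (d g_i / d lam_j)_(i, j). *)
Definition Xrep lam g : 'M[R[i]]_d := (jacobian g lam)^T.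

(* Representations act on column vectors. *)
Definition is_rep (G : set (E -> E)) k (X : (E -> E) -> 'M[R[i]]_k) :=
  X id = 1%:M /\ forall g h, G g -> G h -> X (g \o h) = X g *m X h.

Definition is_irrep (G : set (E -> E)) k (X : (E -> E) -> 'M[R[i]]_k) :=
  [/\ is_rep G X, (0 < k)%N &
      forall U : 'M[R[i]]_k, (forall g, G g -> (U *m (X g)^T <= U)%MS) ->
        U != 0 -> row_full U].

Definition rep_iso (G : set (E -> E)) k l
    (X : (E -> E) -> 'M[R[i]]_k) (Y : (E -> E) -> 'M[R[i]]_l) :=
  exists B : 'M[R[i]]_(k, l),
    [/\ k = l, row_free B & forall g, G g -> X g *m B = B *m Y g].

(* The class K^(k), 1 <= k <= (p + 3) / 2, for p odd.  For k <= (p - 1) / 2 the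
   LFT fmap s lam is the image of g = gmap s under Phi_lam. *)
Definition Kclass (p : nat) lam (k : nat) : set (E -> E) :=
  [set g | stab lam g /\
    if (k <= p.-1./2)%N then
      exists s, g = gmap s /\
        lft_conj (fmap s lam) (rotation (2 * k%:R * pi / p%:R))
    else if k == p.+1./2 then g = id
    else g <> id /\ g \o g = id].

Definition irr_dim (p l : nat) : nat := if (l <= p.-1./2)%N then 2 else 1.

(* The value on K^(k) of the character of X^(l). *)
Definition irr_char (p l k : nat) : R :=
  if (l <= p.-1./2)%N then
    if (k <= p.-1./2)%N then 2 * cos (2 * k%:R * l%:R * pi / p%:R)
    else if k == p.+1./2 then 2 else 0
  else if l == p.+1./2 then 1
  else if k == (p + 3)./2 then -1 else 1.

(* X j is X^(j + 1). *)
Definition dihedral_irreps (p : nat) lam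
    (X : forall j : 'I_((p + 3)./2), (E -> E) -> 'M[R[i]]_(irr_dim p j.+1)) :=
  forall j, is_irrep (stab lam) (X j) /\
    forall k g, (1 <= k <= (p + 3)./2)%N -> Kclass p lam k g ->
      \tr (X j g) = ((irr_char p j.+1 k)%:C)%C.

Definition multiplicity_vector (p : nat) lam (a : seq nat) :=
  size a = (p + 3)./2 /\
  exists X : forall j : 'I_((p + 3)./2), (E -> E) -> 'M[R[i]]_(irr_dim p j.+1),
    dihedral_irreps lam X /\
    rep_iso (stab lam) (Xrep lam)
      (fun g => \mxdiag_(j < (p + 3)./2) \mxdiag_(_ < nth 0%N a j) X j g).

End Configurations.

Section Types.
Variables (R : realType) (p : nat).

Definition Aset : set (sphere R) :=
  [set Some (cis (k%:~R / p%:R * (2 * pi))) | k in [set: int]].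

Definition Bset : set (sphere R) :=
  [set Some (cis ((2 * k%:~R + 1) / (2 * p%:R) * (2 * pi))) | k in [set: int]].

Definition Cset (z : R[i]) : set (sphere R) :=
  [set Some (z * cis (k%:~R / p%:R * (2 * pi))) | k in [set: int]] `|`
  [set Some (z^-1 * cis (k%:~R / p%:R * (2 * pi))) | k in [set: int]].

Definition Cgeneric (z : R[i]) :=
  z != 0 /\ forall l : int, z != cis (l%:~R / (2 * p%:R) * (2 * pi)).

Definition poles : set (sphere R) := [set Some 0] `|` [set None].

(* [lam] is equivalent to the union of S0 and of m distinct sets C_p(a_i). *)
Definition of_form d (m : nat) (S0 : set (sphere R)) (lam : 'rV[R[i]]_d) :=
  exists a : 'I_m -> R[i],
    [/\ forall i, Cgeneric (a i), injective (fun i => Cset (a i)) &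
        sphere_equiv (config lam) (S0 `|` \bigcup_i Cset (a i))].

Definition type_mC d m (lam : 'rV[R[i]]_d) :=
  (1 <= m)%N /\ of_form m set0 lam.
Definition type_A_mC d m (lam : 'rV[R[i]]_d) :=
  of_form m Aset lam.
Definition type_AB_mC d m (lam : 'rV[R[i]]_d) :=
  (1 <= m)%N /\ of_form m (Aset `|` Bset) lam.
Definition type_2_mC d m (lam : 'rV[R[i]]_d) :=
  (1 <= m)%N /\ of_form m poles lam.
Definition type_A_2_mC d m (lam : 'rV[R[i]]_d) :=
  of_form m (Aset `|` poles) lam.
Definition type_AB_2_mC d m (lam : 'rV[R[i]]_d) :=
  (1 <= m)%N /\ of_form m (Aset `|` Bset `|` poles) lam.

End Types.

(* Main.v *)
From mathcomp Require Import all_boot all_order all_algebra fingroup perm.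
From mathcomp Require Import boolp classical_sets functions reals.
From mathcomp Require Import topology normedtype derive landau trigo.
From mathcomp Require Import ring lra zify.
Require Import Defs.

Set Implicit Arguments.
Unset Strict Implicit.
Unset Printing Implicit Defensive.

Import Order.TTheory GRing.Theory Num.Theory numFieldNormedType.Exports.

Local Open Scope classical_set_scope.
Local Open Scope ring_scope.

(** Characters reduce everything to traces.  A representation of the dihedral
    group D_p of odd degree p is determined by the traces of its rotations and
    reflections, so the multiplicity vector follows once the trace of the
    Jacobian of each element of the stabilizer of lambda is known.

    The trace has a geometric reading.  A point of K_n is a configuration of n
    points of the sphere up to linear fractional transformations (LFTs), so its
    tangent space is the direct sum of the n tangent lines of the sphere at these
    points, divided by the three-dimensional space sl_2 of global vector fields.
    If g_sigma fixes lambda, its derivative is induced by the LFT f that permutes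
    the points according to sigma: f acts on the n tangent lines by a monomial
    matrix, whose trace is the sum of the multipliers of f at its fixed points
    among the n points, and on sl_2 by conjugation, with trace tr^2/det - 1 for a
    matrix of f.  Hence (trace_jacobian)

      tr X_lambda(g_sigma) = sum of the multipliers at the fixed points
                             - (tr^2/det - 1).

    It is proved in homogeneous coordinates, where infinity is a point like the
    others.  The points w_i satisfy F w_i = c_i w_(sigma i), with F a matrix of f;
    varying the configuration in this identity shows that the extension of the
    derivative of g_sigma to all n tangent lines differs from the monomial matrix
    with entries det F/c_i^2 by a quadratic form in the image point, that is by a
    vector field of sl_2 (ext_dgmap_quadratic), and the traces of such a
    quotient subtract (trace_quotient).

    An LFT h moves the configuration to one of the listed models, which all have
    the same shape: {0, infinity} or nothing (delta = 1 or 0), together with the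
    points x such that x^p lies in a finite set L of nonzero numbers closed under
    inversion.  Indeed A_p, B_p and C_p(a) are given by x^p = 1, x^p = -1 and
    x^p = a^p or a^-p.  So L has 2 m elements, plus 1 for A_p and 1 for B_p, and
    n = p |L| + 2 delta.  The 2 p LFTs z |-> u z and z |-> u/z with u^p = 1
    preserve the model, so they yield 2 p distinct elements of the stabilizer,
    because sigma |-> g_sigma is injective for n >= 5 (gmap_inj); as the
    stabilizer has order 2 p, there are no others (stabP).  The trace formula
    gives (trace_stab_rep_rot, trace_stab_rep_refl)

      (delta - 1)(u + 1/u) - 1       for z |-> u z with u != 1,
      1 - [1 in L] - [-1 in L]       for z |-> u/z,

    because z |-> u z fixes 0 and infinity with multipliers u and 1/u, while
    z |-> u/z fixes the two square roots of u, with multiplier -1, and their p-th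
    powers are 1 and -1.  At u = 1 the trace is n - 3.

    The decomposition of a representation with these traces is explicit.  The
    projectors onto the eigenspaces of a generating rotation, multiplied by a
    reflection, form systems of matrix units, one for each irreducible
    representation (munitM, munit_act); the rank of a diagonal unit is its trace,
    and it is the multiplicity (matrix_units_basis, dihedral_decomposition).  The
    multiplicities are

      |L| + (delta - 1)[l = 1]            for the two-dimensional X^(l),
      (|L| - [1 in L] - [-1 in L])/2      for the trivial representation,
      (|L| - 2 + [1 in L] + [-1 in L])/2  for the sign representation,

    and the six types prescribe m, delta, and whether 1 and -1 belong to L. *)

(** * Matrix units *)

(** An idempotent has trace equal to its rank in characteristic 0, so it splits
    through a space of dimension its trace. *)
Lemma idempotent_factor (K : numFieldType) d k (E : 'M[K]_d) :
  E *m E = E -> \tr E = k%:R ->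
  exists (c : 'M_(d, k)) (r : 'M_(k, d)), c *m r = E /\ r *m c = 1%:M.
Proof.
move=> EE trE.
have rc : row_base E *m col_base E = 1%:M.
  move: (col_base E) (row_base E) (mulmx_base E) (col_base_full E) (row_base_free E).
  move=> c r cr fc fr.
  have : c *m ((r *m c) *m r) = c *m (1%:M *m r).
    by rewrite mul1mx -mulmxA cr mulmxA cr.
  move/(congr1 (mulmx (pinvmx c))); rewrite [LHS]mulmxA [RHS]mulmxA mulVpmx // !mul1mx.
  by move=> h; apply: (row_free_inj fr); rewrite h mul1mx.
have -> : k = \rank E.
  apply/eqP; rewrite -(eqr_nat K) -trE -{1}(mulmx_base E) mxtrace_mulC rc.
  by rewrite mxtrace1.
by exists (col_base E), (row_base E); rewrite mulmx_base.
Qed.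

Section MatrixUnits.
Variables (K : numFieldType) (d N : nat) (dim mult : 'I_N -> nat).
Variable E : 'I_N -> nat -> nat -> 'M[K]_d.
Hypothesis dim_gt0 : forall j, (0 < dim j)%N.
Hypothesis mulE : forall j k a b c e,
  (a < dim j)%N -> (b < dim j)%N -> (c < dim k)%N -> (e < dim k)%N ->
  E j a b *m E k c e = if (j == k) && (b == c) then E j a e else 0.
Hypothesis trE : forall j, \tr (E j 0%N 0%N) = (mult j)%:R.

(** A family of systems of matrix units, in which the diagonal units of the j-th
    system have rank [mult j], spans copies of the standard modules of dimension
    [dim j], [mult j] of them: let [c] run over a basis of the image of
    [E j 0 0]; the vectors [E j a 0 *m c] form one copy.  The units are indexed by
    natural numbers because the sizes [dim j] vary with [j]. *)
Lemma matrix_units_basis :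
  exists (B : 'M[K]_(d, \sum_j \sum_(_ < mult j) dim j)),
    row_free B^T /\
    forall (X : 'M_d) (Y : forall j, 'M_(dim j)),
      (forall j (a : 'I_(dim j)),
        X *m E j a 0%N = \sum_c Y j c a *: E j c 0%N) ->
      X *m B = B *m \mxdiag_j mxdiag (p_ := fun=> dim j) (fun _ : 'I_(mult j) => Y j).
Proof.
have /fin_all_exists [c /fin_all_exists [r cr]] : forall j, exists c : 'M_(d, mult j),
    exists r : 'M_(mult j, d), c *m r = E j 0%N 0%N /\ r *m c = 1%:M.
  by move=> j; apply: idempotent_factor; rewrite ?trE // mulE // !eqxx.
(* The columns of Bl j i are the i-th copy of the j-th module; the rows of Cl j i
   are the dual vectors, which prove the independence. *)
pose Bl j (i : 'I_(mult j)) : 'M_(d, dim j) :=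
  \matrix_(x, a) (E j a 0%N *m col i (c j)) x 0.
pose Cl j (i : 'I_(mult j)) : 'M_(dim j, d) :=
  \matrix_(a, x) (row i (r j) *m E j 0%N a) 0 x.
have CB j k i i' a b : (Cl j i *m Bl k i') a b =
    (row i (r j) *m (E j 0%N a *m E k b 0%N) *m col i' (c k)) 0 0.
  rewrite -!mulmxA mulmxA [RHS]mxE mxE.
  by apply: eq_bigr => x _; rewrite !mxE.
have rEc j : r j *m E j 0%N 0%N *m c j = 1%:M.
  have [<- rc] := cr j; by rewrite !mulmxA rc mul1mx rc.
(* The block has dim j rows and dim k columns; conform_mx gives the scalar matrix
   this size in the case j = k. *)
have CB1 j k i i' : Cl j i *m Bl k i' =
    if j == k then conform_mx 0 ((i == i' :> nat)%:R%:M : 'M_(dim j)) else 0.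
  apply/matrixP=> a b; rewrite CB mulE //; have [jk|jk] := eqVneq j k; last first.
    by rewrite mulmx0 mul0mx !mxE.
  case: _ / jk in i' b *; rewrite conform_mx_id [RHS]mxE.
  rewrite val_eqE /=; case: eqP => _; last by rewrite mulmx0 mul0mx mulr0n mxE.
  rewrite -row_mul mulr1n.
  have := rEc j; move/(congr1 (fun M : 'M__ => M i i')); rewrite [in X in _ = X]mxE => <-.
  by rewrite !mxE; apply: eq_bigr=> x _; rewrite !mxE.
pose B := \mxrow_j \mxrow_i Bl j i; pose C := \mxcol_j \mxcol_i Cl j i.
have CB_1 : C *m B = 1%:M.
  rewrite mul_mxcol_mxrow -mxdiagZ; apply: eq_mxblock => j k.
  rewrite mul_mxcol_mxrow.
  have [jk|jk] := eqVneq j k; last first.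
    by rewrite -[RHS]mxblock0; apply: eq_mxblock=> i i'; rewrite CB1 (negPf jk).
  case: _ / jk; rewrite conform_mx_id -mxdiagZ; apply: eq_mxblock=> i i'.
  rewrite CB1 eqxx !conform_mx_id -val_eqE.
  by case: eqP => // _; apply/matrixP=> a b; rewrite !mxE mul0rn.
exists B; split.
  rewrite /row_free mxrank_tr eqn_leq rank_leq_col /= -[X in (X <= _)%N](@mxrank1 K) -CB_1.
  exact: mxrankM_maxr.
move=> X Y XE; rewrite mul_mxrow mul_mxrow_mxdiag.
apply: eq_mxrow => j; rewrite mul_mxrow mul_mxrow_mxdiag.
apply: eq_mxrow => i; apply/matrixP=> x b.
have -> : (X *m Bl j i) x b = (X *m E j b 0%N *m col i (c j)) x 0.
  by rewrite -mulmxA !mxE; apply: eq_bigr=> y _; rewrite !mxE.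
rewrite XE mulmx_suml summxE mxE; apply: eq_bigr => a _.
by rewrite -scalemxAl !mxE mulrC.
Qed.
End MatrixUnits.

(** * Representations of the dihedral group of odd degree *)

(** Orthogonality of the characters of a cyclic group. *)
Lemma sum_expr_root (K : fieldType) p (w : K) : w ^+ p = 1 ->
  \sum_(j < p) w ^+ j = if w == 1 then p%:R else 0.
Proof.
move=> wp; case: eqVneq => [->|w1].
  by under eq_bigr do rewrite expr1n; rewrite sumr_const card_ord.
apply: (mulfI (x := w - 1)); first by rewrite subr_eq0.
by rewrite -subrX1 wp subrr mulr0.
Qed.

Section DihedralReps.
Variables (K : numFieldType) (p : nat) (zeta : K).
Hypotheses (p_odd : odd p) (p_ge3 : (3 <= p)%N) (prim : p.-primitive_root zeta).
Let q := p.-1./2.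
Let pE : p = q.*2.+1. Proof. by rewrite /q; lia. Qed.

Let zetap : zeta ^+ p = 1. Proof. exact: prim_expr_order. Qed.
Let zeta_neq0 : zeta != 0.
Proof. by apply: contra_eq_neq zetap => ->; rewrite expr0n; case: p p_ge3 => // *;
  rewrite eq_sym oner_eq0. Qed.

(** The pair [(u, b)] stands for the transformation sending [z] to [u * z], or to
    [u / z] when [b] holds; [dihedral_mul] is composition.  With [u ^+ p = 1] these
    pairs form a concrete model of the dihedral group. *)
Definition dihedral_mul (x y : K * bool) : K * bool :=
  (x.1 * (if x.2 then y.1^-1 else y.1), x.2 (+) y.2).

(** For [l <= q] the rotation [u] is diagonal with entries [u ^+ l] and [u ^- l], and
    the inversion exchanges the two basis vectors; [l = q.+1] is the trivial
    representation and [l = q.+2] the sign.  The size [k] is free so that the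
    irreducibility can be argued in size 2 without transporting along an
    equality of sizes. *)
Definition dihedral_irr_mx k l (x : K * bool) : 'M[K]_k :=
  \matrix_(a, c)
    if (l <= q)%N then
      if x.2 == (a != c) then (if val a == 0%N then x.1 else x.1^-1) ^+ l else 0
    else if x.2 && (l != q.+1) then -1 else 1.

Definition dihedral_irr l (x : K * bool) : 'M[K]_(irr_dim p l) := dihedral_irr_mx _ l x.

Lemma dihedral_irrM l x y : dihedral_irr l (dihedral_mul x y) =
  dihedral_irr l x *m dihedral_irr l y.
Proof.
case: x y => [u b] [v c]; rewrite /dihedral_irr /dihedral_irr_mx /dihedral_mul /irr_dim -/q /=.
case: ifP => lq; apply/matrixP=> i j; rewrite !mxE /=.
  rewrite !big_ord_recl big_ord0 !mxE addr0 /=.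
  case: i j => [[|[|//]] hi] [[|[|//]] hj]; case: b c => [] [] /=;
  by rewrite ?(mulr0,mul0r,addr0,add0r,exprMn,invfM,invrK).
rewrite big_ord1 !mxE.
by case: (l != _); case: b c => [] [] /=; rewrite ?(mulr1,mul1r,mulN1r,opprK).
Qed.

Variables (d : nat) (X : K * bool -> 'M[K]_d).
Definition dihedral_elt (x : K * bool) := x.1 ^+ p == 1.
Hypothesis X1 : X (1, false) = 1%:M.
Hypothesis XM : {in dihedral_elt &, forall x y, X (dihedral_mul x y) = X x *m X y}.

Let p_neq0 : p%:R != 0 :> K. Proof. by rewrite pnatr_eq0; lia. Qed.

(** Fourier projector of the rotation [zeta] onto its [w]-eigenspace.  It is locked
    because rewriting would otherwise compare such sums up to unfolding. *)
Definition eigproj (w : K) : 'M[K]_d :=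
  locked (p%:R^-1 *: \sum_(j < p) (w^-1) ^+ j *: X (zeta ^+ j, false)).

Let rootV (w : K) : w ^+ p = 1 -> w^-1 ^+ p = 1.
Proof. by rewrite exprVn => ->; rewrite invr1. Qed.

Let root_neq0 (w : K) : w ^+ p = 1 -> w != 0.
Proof. by apply: contra_eq_neq => ->; rewrite expr0n pE /= eq_sym oner_eq0. Qed.

Let sum_shift (F : nat -> 'M[K]_d) : F p = F 0 ->
  \sum_(j < p) F j.+1 = \sum_(j < p) F j.
Proof.
move=> Fp; have : \sum_(i < p.+1) F i = \sum_(i < p) F i + F p by rewrite big_ord_recr.
by rewrite big_ord_recl /= Fp addrC => /addIr.
Qed.

Let sum_opp (F : nat -> 'M[K]_d) : F p = F 0 ->
  \sum_(j < p) F (p - j)%N = \sum_(j < p) F j.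
Proof.
move=> Fp; rewrite -sum_shift // (reindex_inj rev_ord_inj) /=.
by apply: eq_bigr => j _; rewrite subKn.
Qed.

Let XM0 u v c : u ^+ p = 1 -> v ^+ p = 1 -> X (u, false) *m X (v, c) = X (u * v, c).
Proof. by move=> up vp; rewrite -XM // unfold_in /dihedral_elt ?up ?vp. Qed.

Let XMt v c : v ^+ p = 1 -> X (1, true) *m X (v, c) = X (v^-1, ~~ c).
Proof.
by move=> vp; rewrite -XM ?unfold_in /dihedral_elt ?expr1n ?vp // /dihedral_mul /= mul1r.
Qed.

Let zetaX i : (zeta ^+ i) ^+ p = 1. Proof. by rewrite exprAC zetap expr1n. Qed.

(** Multiplying by the rotation shifts the summation index cyclically. *)
Lemma eigproj_eig w i : w ^+ p = 1 ->
  X (zeta ^+ i, false) *m eigproj w = w ^+ i *: eigproj w.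
Proof.
move=> wp; elim: i => [|i IH]; first by rewrite !expr0 X1 mul1mx scale1r.
rewrite exprS -XM0 // -mulmxA IH -scalemxAr exprSr -scalerA; congr (_ *: _).
rewrite /eigproj -!lock -scalemxAr scalerA mulrC -scalerA; congr (_ *: _).
pose F j := w^-1 ^+ j *: X (zeta ^+ j, false).
rewrite -[in RHS](sum_shift (F := F)); last by rewrite /F zetap rootV.
rewrite mulmx_sumr scaler_sumr; apply: eq_bigr => j _.
by rewrite -scalemxAr XM0 // /F scalerA !exprS mulrA divff ?mul1r // root_neq0.
Qed.

Lemma eigprojM v w : v ^+ p = 1 -> w ^+ p = 1 ->
  eigproj v *m eigproj w = if v == w then eigproj w else 0.
Proof.
move=> vp wp; rewrite {1}/eigproj -lock -scalemxAl mulmx_suml.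
under eq_bigr do rewrite -scalemxAl eigproj_eig // scalerA -exprMn.
rewrite -scaler_suml sum_expr_root; last by rewrite exprMn wp rootV // mulr1.
have v0 := root_neq0 vp.
rewrite -(inj_eq (mulfI v0)) mulrA divff // mul1r mulr1 eq_sym.
by case: eqP; rewrite ?scale0r ?scaler0 // scalerA mulVf // scale1r.
Qed.

Let Q b := X (1, b).

Let QQ b c : Q b *m Q c = Q (b (+) c).
Proof. by case: b; rewrite /Q ?XMt ?XM0 ?expr1n // ?invr1 ?mulr1. Qed.

(** The reflection inverts the rotation, so it exchanges the eigenspaces of [w]
    and [w^-1]. *)
Let Qeig b w : w ^+ p = 1 ->
  Q b *m eigproj w = eigproj (if b then w^-1 else w) *m Q b.
Proof.
move=> wp; case: b; last by rewrite /Q X1 mulmx1 mul1mx.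
rewrite /eigproj -!lock -scalemxAr -scalemxAl; congr (_ *: _).
rewrite mulmx_sumr mulmx_suml invrK.
pose F j := w ^+ j *: X (zeta ^+ j, true).
transitivity (\sum_(j < p) F j).
  rewrite -sum_opp; last by rewrite /F zetap wp.
  apply: eq_bigr => j _; rewrite /Q -scalemxAr XMt // /F.
  have pj : (p - j + j)%N = p by rewrite subnK // ltnW.
  congr (_ *: X (_, _)).
    apply: (mulIf (expf_neq0 j (root_neq0 wp))).
    by rewrite -exprD pj wp exprVn mulVf // expf_neq0 // root_neq0.
  apply: (mulIf (expf_neq0 j zeta_neq0)).
  by rewrite -exprD pj zetap mulVf // expf_neq0.
by apply: eq_bigr => j _; rewrite -scalemxAl /Q XM0 ?expr1n // mulr1.
Qed.

(** The eigenvalues of the rotation [zeta] on the two basis vectors of the [l]-th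
    two-dimensional representation. *)
Let rt l (a : nat) := (if a == 0%N then zeta else zeta^-1) ^+ l.

Let rtp l a : rt l a ^+ p = 1.
Proof. by rewrite /rt; case: ifP; rewrite // exprAC ?rootV // expr1n. Qed.

Let rtV l (a : nat) : (rt l a)^-1 = rt l (a == 0%N).
Proof. by rewrite /rt; case: eqP => _; rewrite /= ?exprVn ?invrK. Qed.

Let rtE l : (0 < l <= q)%N -> forall a, rt l a = zeta ^+ (if a == 0%N then l else p - l)%N.
Proof.
move=> lq a; rewrite /rt; case: eqP => // _.
apply: (mulIf (expf_neq0 l zeta_neq0)).
by rewrite -exprD subnK ?zetap ?exprVn ?mulVf ?expf_neq0 //; lia.
Qed.

Let rt_eq l l' a c : (0 < l <= q)%N -> (0 < l' <= q)%N ->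
  (rt l a == rt l' c) = (l == l') && ((a == 0%N) == (c == 0%N)).
Proof.
move=> lq lq'; rewrite !rtE // (eq_prim_root_expr prim).
by rewrite !modn_small; case: (a == 0%N); case: (c == 0%N); lia.
Qed.

Let rt_neq1 l a : (0 < l <= q)%N -> (rt l a == 1) = false.
Proof.
move=> lq; rewrite rtE // -(expr0 zeta) (eq_prim_root_expr prim).
by rewrite !modn_small; case: (a == 0%N); lia.
Qed.

(** The value on reflections of the one-dimensional representations. *)
Definition refl_sign l : K := if l == q.+1 then 1 else -1.

(** The matrix unit of the [l]-th irreducible representation, in the basis in
    which [dihedral_irr] is written: project onto the [b]-th eigenspace and carry it
    to the [a]-th one by the reflection when [a] and [b] differ.  In the
    one-dimensional cases, the projector onto the vectors fixed by the rotations is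
    cut into the eigenspaces of the reflection. *)
Definition munit l a b : 'M[K]_d :=
  if (l <= q)%N then eigproj (rt l a) *m Q (a != b)
  else 2^-1 *: (eigproj 1 + refl_sign l *: (eigproj 1 *m Q true)).

Let e1p : 1 ^+ p = 1 :> K. Proof. exact: expr1n. Qed.

(** The eigenvalues [zeta ^+ l] and [zeta ^- l] for [0 < l <= q] are pairwise distinct
    and different from 1, because [p = 2 q + 1]; so the projectors involved are
    orthogonal. *)
Lemma munitM l l' a b c e : (0 < l <= q.+2)%N -> (0 < l' <= q.+2)%N ->
  (a < irr_dim p l)%N -> (b < irr_dim p l)%N ->
  (c < irr_dim p l')%N -> (e < irr_dim p l')%N ->
  munit l a b *m munit l' c e = if (l == l') && (b == c) then munit l a e else 0.
Proof.
rewrite /irr_dim -/q /munit => /andP[l0 lq] /andP[l0' lq'].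
have QE b' : Q b' *m eigproj 1 = eigproj 1 *m Q b'.
  by rewrite Qeig // invr1; case: b'.
case: ifP => hl; case: ifP => hl' ha hb hc he.
- rewrite -mulmxA [Q _ *m _]mulmxA Qeig // -mulmxA QQ mulmxA eigprojM //; last first.
    by case: ifP; rewrite ?rootV.
  have -> : (rt l a == (if a != b then (rt l' c)^-1 else rt l' c)) = (l == l') && (b == c).
    rewrite rtV -(fun_if (rt l')) rt_eq ?l0 ?hl ?l0' //; congr (_ && _).
    by case: a b c ha hb hc {he} => [|[|//]] [|[|//]] [|[|//]].
  case: andP => [[/eqP ll /eqP bc]|_]; last by rewrite mul0mx.
  subst l' c; congr (eigproj _ *m Q _).
    by case: a b ha hb {hc he} => [|[|//]] [|[|//]] //= _ _; rewrite rtV.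
  by case: a b e ha hb he {hc} => [|[|//]] [|[|//]] [|[|//]].
(* A two-dimensional unit lives on eigenvalues different from 1, a
   one-dimensional one on the eigenvalue 1. *)
- have -> : (l == l') = false by apply/eqP=> ll; rewrite -ll hl in hl'.
  have z : eigproj (rt l a) *m Q (a != b) *m eigproj 1 = 0.
    by rewrite -mulmxA QE mulmxA eigprojM // rt_neq1 ?l0 // mul0mx.
  by rewrite -scalemxAr mulmxDr -scalemxAr mulmxA !z mul0mx scaler0 addr0 scaler0.
- have -> : (l == l') = false by apply/eqP=> ll; rewrite -ll hl in hl'.
  have z : eigproj 1 *m eigproj (rt l' c) = 0.
    by rewrite eigprojM // eq_sym rt_neq1 ?l0'.
  rewrite -scalemxAl mulmxDl -scalemxAl -QE -[Q true *m _ *m _]mulmxA.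
  by rewrite [eigproj 1 *m (_ *m _)]mulmxA z mul0mx mulmx0 scaler0 addr0 scaler0.
- case: b c hb hc {ha he} => [|//] [|//] _ _; rewrite andbT.
  rewrite -scalemxAl -scalemxAr scalerA mulmxDr !mulmxDl -!(scalemxAl, scalemxAr).
  have -> : eigproj 1 *m Q true *m (eigproj 1 *m Q true) = eigproj 1.
    by rewrite mulmxA -[_ *m Q true *m _]mulmxA QE mulmxA -mulmxA QQ eigprojM // eqxx /Q X1 mulmx1.
  rewrite -[_ *m Q true *m eigproj 1]mulmxA QE !mulmxA eigprojM // eqxx.
  have ll : (l == l') = (refl_sign l == refl_sign l').
    have n11 : (1 == -1 :> K) = false by rewrite -subr_eq0 opprK -mulr2n pnatr_eq0.
    have n11' : (-1 == 1 :> K) = false by rewrite eq_sym.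
    rewrite /refl_sign; case: (eqVneq l q.+1); case: (eqVneq l' q.+1);
    by rewrite ?eqxx ?n11 ?n11'; lia.
  rewrite ll {ll}; set e1 := eigproj 1; set eQ := e1 *m _.
  have sg k : (refl_sign k == 1) || (refl_sign k == -1) by rewrite /refl_sign; case: ifP;
    rewrite eqxx ?orbT.
  have half (x : 'M[K]_d) : (2^-1 / 2) *: (x + x) = 2^-1 *: x.
    by rewrite -mulr2n -scalerMnr scalerMnl -mulr_natr mulfVK // pnatr_eq0.
  have n11 : (1 == -1 :> K) = false by rewrite -subr_eq0 opprK -mulr2n pnatr_eq0.
  have n11' : (-1 == 1 :> K) = false by rewrite eq_sym.
  case/orP: (sg l) => /eqP ->; case/orP: (sg l') => /eqP ->;
    rewrite ?eqxx ?n11 ?n11' ?scale1r ?scaleN1r ?opprK.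
  + by rewrite [eQ + e1]addrC half.
  + by rewrite -opprD [eQ + e1]addrC subrr scaler0.
  + by rewrite -[eQ - e1]opprB subrr scaler0.
  + by rewrite [- eQ + e1]addrC half.
Qed.

(** The group acts on the first column of the matrix units through the
    irreducible representation: this is what makes [matrix_units_basis] applicable. *)
Lemma munit_act l x (a : 'I_(irr_dim p l)) : (0 < l <= q.+2)%N -> x \in dihedral_elt ->
  X x *m munit l a 0 = \sum_c dihedral_irr l x c a *: munit l c 0.
Proof.
case: x => u b /andP[l0 lq] /eqP /= up.
have [i iu] : exists i, u = zeta ^+ i.
  by have [i ->] := prim_rootP prim up; exists i.
have -> : X (u, b) = X (u, false) *m Q b by rewrite /Q XM0 ?expr1n // mulr1.
rewrite -mulmxA /munit /dihedral_irr /dihedral_irr_mx.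
under eq_bigr do rewrite mxE -/q.
move: a; rewrite /irr_dim -/q; case: ifP => hl a.
  rewrite mulmxA -[X _ *m _ *m _]mulmxA [Q b *m _]mulmxA Qeig // [X _ *m _]mulmxA [X _ *m _]mulmxA.
    rewrite rtV -(fun_if (rt l)) iu eigproj_eig // -!scalemxAl -mulmxA QQ.
    rewrite !big_ord_recl big_ord0 addr0 /=.
    case: a => -[|[|//]] ha; case: b; rewrite /= ?scale0r ?addr0 ?add0r /rt /=;
      by rewrite -?exprVn exprAC.
have QE : Q b *m eigproj 1 = eigproj 1 *m Q b by rewrite Qeig // invr1 if_same.
have Xe : X (u, false) *m eigproj 1 = eigproj 1 by rewrite iu eigproj_eig // expr1n scale1r.
rewrite big_ord1 /= -!scalemxAr mulmxDr -scalemxAr mulmxA QE -mulmxA QQ.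
rewrite mulmxDr -scalemxAr !mulmxA Xe.
rewrite scalerA [_ * 2^-1]mulrC -scalerA; congr (_ *: _).
have eQ0 : eigproj 1 *m Q false = eigproj 1 by rewrite /Q X1 mulmx1.
case: b {QE} => /=; last by rewrite scale1r eQ0.
rewrite eQ0 addrC /refl_sign; case: eqP => _; rewrite ?scale1r //.
by rewrite !scaleN1r opprD opprK.
Qed.

(** The shape of the character of the representations on tangent spaces of K_n:
    [s] is the number of regular [p]-gons in the configuration, and [delta] tells
    whether the two fixed points of the rotations belong to it. *)
Variables (s : nat) (delta t : K).
Hypothesis trXr : forall u, u ^+ p = 1 ->
  \tr (X (u, false)) = (delta - 1) * (u + u^-1) - 1 + (if u == 1 then p%:R * s%:R else 0).
Hypothesis trXs : forall u, u ^+ p = 1 -> \tr (X (u, true)) = t.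

(** Fourier inversion of the trace: [u + u^-1] contributes at [zeta] and [zeta^-1], the
    constant -1 at the eigenvalue 1, and the Dirac mass at the identity everywhere. *)
Lemma trace_eigproj w : w ^+ p = 1 ->
  \tr (eigproj w) = s%:R + (delta - 1) * ((w == zeta)%:R + (w == zeta^-1)%:R) - (w == 1)%:R.
Proof.
move=> wp; rewrite /eigproj -lock linearZ /= raddf_sum /=.
have w0 := root_neq0 wp.
transitivity (p%:R^-1 * ((delta - 1) * (\sum_(j < p) (w^-1 * zeta) ^+ j +
    \sum_(j < p) (w^-1 * zeta^-1) ^+ j) - \sum_(j < p) w^-1 ^+ j + p%:R * s%:R)).
  congr (_ * _); have -> : p%:R * s%:R =
      \sum_(j < p) (w^-1 ^+ j * (if zeta ^+ j == 1 then p%:R * s%:R else 0)).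
    have p0 : (0 < p)%N by lia.
    rewrite (bigD1 (Ordinal p0)) //= !expr0 eqxx mul1r big1 ?addr0 // => j.
    rewrite -val_eqE /= => j0.
    by rewrite -[1](expr0 zeta) (eq_prim_root_expr prim) !modn_small // (negPf j0) mulr0.
  rewrite -big_split mulr_sumr -sumrB -big_split /=; apply: eq_bigr => j _.
  rewrite mxtraceZ trXr // !exprMn !exprVn. by rewrite mulrDr mulrBr mulr1 mulrCA mulrDr.
rewrite !sum_expr_root ?exprMn ?rootV ?zetap ?mulr1 //.
have -> : (w^-1 * zeta == 1) = (w == zeta).
  by rewrite -(inj_eq (mulfI w0)) mulrA divff // mul1r mulr1 eq_sym.
have -> : (w^-1 * zeta^-1 == 1) = (w == zeta^-1).
  by rewrite -(inj_eq (mulfI w0)) mulrA divff // mul1r mulr1 eq_sym.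
have -> : (w^-1 == 1) = (w == 1) by rewrite -[in LHS](invr1 K) (inj_eq invr_inj).
case: (w == zeta); case: (w == _^-1); case: (w == 1); rewrite ?mulr1n ?mulr0n.
all: by field.
Qed.

Lemma trace_munit l : (0 < l <= q.+2)%N -> \tr (munit l 0 0) =
  if (l <= q)%N then s%:R + (delta - 1) * (l == 1%N)%:R else (s%:R - 1 + refl_sign l * t) / 2.
Proof.
move=> /andP[l0 lq]; rewrite /munit; case: ifP => hl.
  rewrite /Q X1 mulmx1 trace_eigproj // rt_neq1 ?l0 // subr0.
  have zE : zeta = rt 1 0 by rewrite /rt expr1.
  have zVE : zeta^-1 = rt 1 1 by rewrite /rt expr1.
  by rewrite zVE zE !rt_eq ?l0 //= ?andbT ?andbF ?addr0 //; lia.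
rewrite mxtraceZ mxtraceD mxtraceZ mulrC trace_eigproj //.
have -> : \tr (eigproj 1 *m Q true) = t.
  rewrite /eigproj -lock -scalemxAl mxtraceZ mulmx_suml raddf_sum /=.
  under eq_bigr do rewrite invr1 expr1n scale1r /Q XM0 ?expr1n // trXs ?mulr1 //.
  by rewrite sumr_const card_ord -[t *+ p]mulr_natl mulrA mulVf // mul1r.
have zE : zeta = rt 1 0 by rewrite /rt expr1.
have zVE : zeta^-1 = rt 1 1 by rewrite /rt expr1.
by rewrite zVE zE eqxx ![1 == _]eq_sym !rt_neq1 ?addr0 ?mulr0 ?addr0 //; lia.
Qed.

(** The multiplicities are read off the traces of the diagonal matrix units. *)
Lemma dihedral_decomposition (a : seq nat) :
  (forall l, (0 < l <= q.+2)%N -> (nth 0 a l.-1)%:R =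
    if (l <= q)%N then s%:R + (delta - 1) * (l == 1%N)%:R else (s%:R - 1 + refl_sign l * t) / 2) ->
  exists B : 'M_(d, \sum_(j < (p + 3)./2) \sum_(_ < nth 0%N a j) irr_dim p j.+1),
    row_free B^T /\ forall x, x \in dihedral_elt ->
      X x *m B = B *m \mxdiag_(j < (p + 3)./2) \mxdiag_(_ < nth 0%N a j) dihedral_irr j.+1 x.
Proof.
move=> ha; have N : (p + 3)./2 = q.+2 by rewrite /q; lia.
have lt (j : 'I_((p + 3)./2)) : (0 < j.+1 <= q.+2)%N by rewrite /= -N.
have [|j k i b c e|j|B [Bf BX]] := @matrix_units_basis K d ((p + 3)./2)
    (fun j => irr_dim p j.+1) (fun j => nth 0%N a j) (fun j => munit j.+1).
- by move=> j; rewrite /irr_dim; case: ifP.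
- by move=> *; rewrite munitM // eqSS val_eqE.
- by rewrite trace_munit // -ha.
exists B; split=> // x xr; apply: BX => j i.
exact: munit_act.
Qed.

Lemma dihedral_irr1 l : dihedral_irr l (1, false) = 1%:M.
Proof.
rewrite /dihedral_irr /dihedral_irr_mx; apply/matrixP=> i j; rewrite !mxE /= invr1 if_same expr1n.
rewrite /irr_dim -/q in i j *; case: ifP i j => lq i j; first by case: (i == j).
by rewrite !ord1 eqxx.
Qed.

Lemma trace_dihedral_irr_rot l u : \tr (dihedral_irr l (u, false)) =
  if (l <= q)%N then u ^+ l + u^-1 ^+ l else 1.
Proof.
rewrite /mxtrace; under eq_bigr do rewrite /dihedral_irr /dihedral_irr_mx mxE /= eqxx /=.
rewrite /irr_dim -/q; case: ifP => _; rewrite ?big_ord1 //.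
by rewrite !big_ord_recl big_ord0 addr0.
Qed.

Lemma trace_dihedral_irr_refl l u : \tr (dihedral_irr l (u, true)) =
  if (l <= q)%N then 0 else if l == q.+1 then 1 else -1.
Proof.
rewrite /mxtrace; under eq_bigr do rewrite /dihedral_irr /dihedral_irr_mx mxE /= eqxx /=.
rewrite /irr_dim -/q; case: ifP => _; first by rewrite big1.
by rewrite big_ord1; case: eqP.
Qed.

Let dihedral_irr_mx_irreducible k l (U : 'M[K]_k) : (0 < l)%N -> k = (if l <= q then 2 else 1)%N ->
  (forall x, x \in dihedral_elt -> (U *m (dihedral_irr_mx k l x)^T <= U)%MS) -> U != 0 ->
    row_full U.
Proof.
rewrite /dihedral_irr_mx => l0 kE; case: ifP kE U => lq -> U UX U0; last first.
  by rewrite /row_full rank_rV U0.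
have /existsP[i /existsP[j Uij]] : [exists i, [exists j, U i j != 0]].
  apply: contraNT U0; rewrite negb_exists => /forallP U0.
  apply/eqP/matrixP=> i j; rewrite mxE; apply/eqP.
  by have := U0 i; rewrite negb_exists => /forallP /(_ j); rewrite negbK.
have Ui x : x \in dihedral_elt -> forall v : 'rV_2, (v <= U)%MS ->
    (v *m (\matrix_(a, c) if x.2 == (a != c) then
       (if val a == 0%N then x.1 else x.1^-1) ^+ l else 0)^T <= U)%MS.
  by move=> xr v vU; apply: submx_trans (UX x xr); apply: submxMr.
have zr : (zeta, false) \in dihedral_elt by rewrite unfold_in /dihedral_elt zetap.
have sr : (1, true) \in dihedral_elt by rewrite unfold_in /dihedral_elt expr1n.
(* Apply zeta - w to the row v, where w is the eigenvalue on the other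
   coordinate: only the j-th coordinate survives. *)
have dj : ((delta_mx 0 j : 'rV_2) <= U)%MS.
  pose v := row i U; pose w := rt l (j == 0%N :> nat).
  have vU : (v <= U)%MS by apply: row_sub.
  have := Ui _ zr v vU.
  have wN : w != rt l j by rewrite /w rt_eq ?l0 ?lq // eqxx; case: (j == 0%N :> nat).
  pose c := (rt l j - w) * v 0 j.
  have c0 : c != 0 by apply: mulf_neq0; [rewrite subr_eq0 eq_sym | rewrite mxE].
  move/(fun h => addmx_sub h (scalemx_sub (- w) vU))/(scalemx_sub c^-1).
  match goal with |- is_true (submx ?M _) -> _ =>
    have E : M = delta_mx 0 j; last by rewrite E end.
  apply/rowP=> x; rewrite !mxE.
  rewrite !big_ord_recl big_ord0 !mxE /=.
  have cE : c = (rt l j - w) * U i j by rewrite /c /v mxE.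
  apply: (mulfI c0); rewrite mulrA divff // mul1r cE /w {c c0 cE wN w v vU}.
  have o0 h : @Ordinal 2 0 h = ord0 by apply: val_inj.
  have o1 h : @Ordinal 2 1 h = lift ord0 ord0 by apply: val_inj.
  case: j Uij x => -[|[|//]] hj Uij [[|[|//]] hk] /=; rewrite ?o0 ?o1 /rt /=.
  - by rewrite mulr1 mulr0 addr0 mulrBl addrC -mulNr; ring.
  - ring.
  - ring.
  - ring.
have xk y : (delta_mx 0 y : 'rV_2) = (if y == j then delta_mx 0 j else
     delta_mx 0 j *m (\matrix_(a, c) if (1 : K, true).2 == (a != c) then
       (if val a == 0%N then (1 : K, true).1 else (1 : K, true).1^-1) ^+ l else 0)^T).
  case: eqVneq => [->//|]; rewrite -rowE => yj; apply/rowP=> x;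
    rewrite !mxE /= invr1 if_same expr1n.
  move: yj; rewrite -!val_eqE /=.
  by case: x y j {Uij dj} => -[|[|//]] ? [[|[|//]] ?] [[|[|//]] ?].
rewrite -sub1mx; apply/row_subP=> y; rewrite rowE mulmx1 xk.
by case: ifP => // _; apply: Ui.
Qed.

(** In the two-dimensional case the rotation [zeta] has two distinct eigenvalues, so
    an invariant subspace that contains a vector with a nonzero [j]-th coordinate
    contains the [j]-th basis vector, and the reflection yields the other one. *)
Lemma dihedral_irr_irreducible l (U : 'M[K]_(irr_dim p l)) : (0 < l)%N ->
  (forall x, x \in dihedral_elt -> (U *m (dihedral_irr l x)^T <= U)%MS) -> U != 0 -> row_full U.
Proof. by move=> l0; apply: dihedral_irr_mx_irreducible l0 _. Qed.

End DihedralReps.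

(** * Linear fractional transformations in homogeneous coordinates *)

Section LFT.
Variable R : realType.
Implicit Types (z w u v : sphere R) (x y a b c d : R[i]).

(** Homogeneous coordinates [(hom_x z, hom_y z)] of a point: [(x, 1)] or [(1, 0)].
    They turn an LFT into a linear map and remove the case distinction at infinity. *)
Definition hom_x z : R[i] := if z is Some x then x else 1.
Definition hom_y z : R[i] := if z is Some x then 1 else 0.
Definition of_hom x y : sphere R := if y == 0 then None else Some (x / y).

Lemma hom_neq0 z : (hom_x z != 0) || (hom_y z != 0).
Proof. by case: z => [x|] /=; rewrite oner_eq0 // orbT. Qed.

Lemma of_homK z : of_hom (hom_x z) (hom_y z) = z.
Proof. by case: z => [x|]; rewrite /of_hom /= ?eqxx ?oner_eq0 ?divr1. Qed.

Lemma lftE a b c d z :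
  lft a b c d z = of_hom (a * hom_x z + b * hom_y z) (c * hom_x z + d * hom_y z).
Proof. by case: z => [x|]; rewrite /of_hom /= ?mulr1 ?mulr0 ?addr0. Qed.

(** Two points of the projective line are equal when the determinant of their
    coordinate vectors vanishes. *)
Lemma of_hom_eq x y z : (x != 0) || (y != 0) ->
  of_hom x y = z <-> x * hom_y z = y * hom_x z.
Proof.
rewrite /of_hom; case: (eqVneq y 0) => [->|y0]; rewrite ?orbF => x0.
  case: z => [w|]; rewrite /= ?mul0r ?mulr1 ?mulr0 //.
  by split=> // xx; rewrite xx !eqxx in x0.
case: z => [w|]; rewrite /= ?mulr1 ?mulr0; last by split=> // /esym/eqP; rewrite (negPf y0).
split=> [[<-]|->]; first by rewrite mulrC divfK.
by rewrite mulrC mulKf.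
Qed.

Lemma sphere_eq z z' : z = z' <-> hom_x z * hom_y z' = hom_y z * hom_x z'.
Proof. by rewrite -{1}(of_homK z); apply: of_hom_eq; apply: hom_neq0. Qed.

Lemma of_hom_vec x y : (x != 0) || (y != 0) -> exists2 k, k != 0
  & x = k * hom_x (of_hom x y) /\ y = k * hom_y (of_hom x y).
Proof.
rewrite /of_hom; case: (eqVneq y 0) => [->|y0]; rewrite ?orbF => x0.
  by exists x; rewrite //= mulr1 mulr0.
by exists y; rewrite //= mulr1 mulrC divfK.
Qed.

Lemma of_hom_scale k x y : k != 0 -> of_hom (k * x) (k * y) = of_hom x y.
Proof.
move=> k0; rewrite /of_hom mulf_eq0 (negPf k0) /=; case: ifP => // _.
by rewrite -mulf_div divff // mul1r.
Qed.

Lemma mx2_vec_neq0 a b c d x y : a * d - b * c != 0 -> (x != 0) || (y != 0) ->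
  (a * x + b * y != 0) || (c * x + d * y != 0).
Proof.
move=> D; apply: contraTT; rewrite !negb_or !negbK => /andP[/eqP h1 /eqP h2].
have hx0 : (a * d - b * c) * x = 0.
  by transitivity (d * (a * x + b * y) - b * (c * x + d * y)); [ring | rewrite h1 h2; ring].
have hy0 : (a * d - b * c) * y = 0.
  by transitivity (a * (c * x + d * y) - c * (a * x + b * y)); [ring | rewrite h1 h2; ring].
move: hx0 hy0 => /eqP; rewrite mulf_eq0 (negPf D) /= => -> /eqP.
by rewrite mulf_eq0 (negPf D).
Qed.

(** An LFT is the action of its matrix on lines: on the chosen coordinate vectors
    the matrix acts up to a nonzero multiplier. *)
Lemma lft_vec a b c d z : a * d - b * c != 0 -> exists2 k, k != 0 &
  a * hom_x z + b * hom_y z = k * hom_x (lft a b c d z) /\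
    c * hom_x z + d * hom_y z = k * hom_y (lft a b c d z).
Proof. by move=> D; rewrite lftE; apply/of_hom_vec/mx2_vec_neq0/hom_neq0. Qed.

Lemma lft_eq a b c d z w : a * d - b * c != 0 ->
  lft a b c d z = w <-> (a * hom_x z + b * hom_y z) * hom_y w =
    (c * hom_x z + d * hom_y z) * hom_x w.
Proof. by move=> D; rewrite lftE; apply/of_hom_eq/mx2_vec_neq0/hom_neq0. Qed.

Lemma lft_comp a b c d a' b' c' d' z : a * d - b * c != 0 -> a' * d' - b' * c' != 0 ->
  lft a b c d (lft a' b' c' d' z) =
  lft (a * a' + b * c') (a * b' + b * d') (c * a' + d * c') (c * b' + d * d') z.
Proof.
move=> D D'; have [k k0 [h1 h2]] := lft_vec z D'.
rewrite [LHS]lftE [RHS]lftE -(of_hom_scale _ _ k0); congr of_hom.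
  transitivity (a * (k * hom_x (lft a' b' c' d' z)) + b * (k * hom_y (lft a' b' c' d' z)));
    first by ring.
  by rewrite -h1 -h2; ring.
transitivity (c * (k * hom_x (lft a' b' c' d' z)) + d * (k * hom_y (lft a' b' c' d' z)));
  first by ring.
by rewrite -h1 -h2; ring.
Qed.

Lemma is_lft_comp (f g : sphere R -> sphere R) : is_lft f -> is_lft g -> is_lft (f \o g).
Proof.
move=> [a [b [c [d [D ->]]]]] [a' [b' [c' [d' [D' ->]]]]].
exists (a * a' + b * c'), (a * b' + b * d'), (c * a' + d * c'), (c * b' + d * d'); split.
  have -> : (a * a' + b * c') * (c * b' + d * d') - (a * b' + b * d') * (c * a' + d * c') =
    (a * d - b * c) * (a' * d' - b' * c') by ring.
  exact: mulf_neq0.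
by apply/funext => z; rewrite /= lft_comp.
Qed.

Lemma is_lft_id : is_lft (@id (sphere R)).
Proof.
exists 1, 0, 0, 1; rewrite mulr1 mulr0 subr0 oner_neq0; split=> //.
by apply/funext => z; rewrite lftE !mul1r !mul0r addr0 add0r of_homK.
Qed.

Lemma is_lft_inv (f : sphere R -> sphere R) : is_lft f ->
  exists g, [/\ is_lft g, cancel f g & cancel g f].
Proof.
move=> [a [b [c [d [D ->]]]]]; have D' : d * a - (- b) * (- c) != 0.
  by have -> : d * a - (- b) * (- c) = a * d - b * c by ring.
exists (lft d (- b) (- c) a); split; first by exists d, (- b), (- c), a.
  move=> z; rewrite lft_comp // lftE -[RHS]of_homK -(of_hom_scale (hom_x z) (hom_y z) D).
  by congr of_hom; ring.
move=> z; rewrite lft_comp // lftE -[RHS]of_homK -(of_hom_scale (hom_x z) (hom_y z) D).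
by congr of_hom; ring.
Qed.

Lemma lft_fix01oo (f : sphere R -> sphere R) : is_lft f -> f (Some 0) = Some 0 ->
  f (Some 1) = Some 1 -> f None = None -> f = id.
Proof.
move=> [a [b [c [d [D ->]]]]].
move=> /(lft_eq _ _ D) b0 /(lft_eq _ _ D) acd /(lft_eq _ _ D) c0.
move: b0 acd c0; rewrite /= !mulr0 !mulr1 !add0r !addr0 => b0.
subst b; rewrite addr0 => acd c0.
apply/funext=> z; apply/(lft_eq z z D).
by rewrite acd -c0; ring.
Qed.

(** The determinant of two coordinate vectors, which vanishes exactly when the
    points coincide. *)
Definition sphere_bracket (z w : sphere R) : R[i] := hom_x z * hom_y w - hom_x w * hom_y z.

Lemma sphere_bracket_neq0 z w : z <> w -> sphere_bracket z w != 0.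
Proof. by move=> zw; apply/negP; rewrite subr_eq0 => /eqP;
  rewrite [X in _ = X]mulrC => /sphere_eq. Qed.

Lemma sphere_bracketzz z : sphere_bracket z z = 0. Proof. by rewrite /sphere_bracket subrr. Qed.

(** The cross-ratio: as a function of [z] it is [z u][v w] / ([z w][v u]), where
    [a b] denotes the bracket of [a] and [b] (see [to01ooE]). *)
Definition to01oo (u v w : sphere R) :=
  lft (sphere_bracket v w * hom_y u) (- (sphere_bracket v w * hom_x u))
      (sphere_bracket v u * hom_y w) (- (sphere_bracket v u * hom_x w)).

Lemma to01ooE u v w z : to01oo u v w z =
  of_hom (sphere_bracket z u * sphere_bracket v w) (sphere_bracket z w * sphere_bracket v u).
Proof. by rewrite /to01oo lftE /sphere_bracket; congr of_hom; ring. Qed.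

Lemma to01oo_det u v w : (sphere_bracket v w * hom_y u) * (- (sphere_bracket v u * hom_x w))
  - (- (sphere_bracket v w * hom_x u)) * (sphere_bracket v u * hom_y w) =
  sphere_bracket v w * sphere_bracket v u * sphere_bracket u w.
Proof. by rewrite /sphere_bracket; ring. Qed.

Lemma is_lft_to01oo u v w : u <> v -> v <> w -> u <> w -> is_lft (to01oo u v w).
Proof.
move=> uv vw uw; eexists _, _, _, _; split; last reflexivity.
by rewrite to01oo_det !mulf_neq0 ?sphere_bracket_neq0 // => /esym.
Qed.

Lemma to01oo_spec u v w : u <> v -> v <> w -> u <> w ->
  [/\ to01oo u v w u = Some 0, to01oo u v w v = Some 1 & to01oo u v w w = None].
Proof.
move=> uv vw uw; have vu := nesym uv.
rewrite !to01ooE !sphere_bracketzz !mul0r /of_hom eqxx [sphere_bracket v w * sphere_bracket v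
  u]mulrC.
by split; rewrite ?mulf_eq0 ?(negPf (sphere_bracket_neq0 _)) //= ?mul0r // divff // mulf_neq0
  // sphere_bracket_neq0.
Qed.

Lemma lft_inj (f : sphere R -> sphere R) : is_lft f -> injective f.
Proof. by move=> /is_lft_inv [g [_ fg _]]; apply: can_inj fg. Qed.

(** LFTs are determined by three values: move the three points to 0, 1, infinity and
    apply [lft_fix01oo]. *)
Lemma lft_eq3 (f g : sphere R -> sphere R) u v w : is_lft f -> is_lft g -> u <> v ->
  v <> w -> u <> w ->
  f u = g u -> f v = g v -> f w = g w -> f = g.
Proof.
move=> lf lg uv vw uw fu fv fw.
have [g' [lg' gg' g'g]] := is_lft_inv lg.
have lt := is_lft_to01oo uv vw uw; have [t' [lt' tt' t't]] := is_lft_inv lt.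
have [tu tv tw] := to01oo_spec uv vw uw.
set t := to01oo u v w in lt tt' t't tu tv tw.
have : t \o (g' \o (f \o t')) = id.
  apply: lft_fix01oo.
  - by do ![apply: is_lft_comp => //].
  - by rewrite /= -{1}tu tt' fu gg'.
  - by rewrite /= -{1}tv tt' fv gg'.
  - by rewrite /= -{1}tw tt' fw gg'.
move=> H; apply/funext=> z; have /(congr1 (fun h => h (t z))) := H.
by rewrite /= tt' => /(can_inj tt') /(congr1 g); rewrite g'g.
Qed.

(** By uniqueness, the LFT obtained by choice is the explicit cross-ratio. *)
Lemma lft_to_01ooE u v w : u <> v -> v <> w -> u <> w -> lft_to_01oo u v w = to01oo u v w.
Proof.
move=> uv vw uw; have [tu tv tw] := to01oo_spec uv vw uw.
have [] := @getPex _ [set f : sphere R -> sphere R | is_lft f /\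
  [/\ f u = Some 0, f v = Some 1 & f w = None]].
  by exists (to01oo u v w); split=> //; apply: is_lft_to01oo.
rewrite -/(lft_to_01oo u v w) => lf [fu fv fw].
by apply: (lft_eq3 lf (is_lft_to01oo uv vw uw) uv vw uw); rewrite ?fu ?fv ?fw.
Qed.

End LFT.

(** * Normalized configurations and the maps g_sigma *)

Section Normalization.
Variables (R : realType) (d : nat).
Notation E := 'rV[R[i]]_d.
Implicit Types (lam mu : E) (s t : 'S_(3 + d)) (f : sphere R -> sphere R).

Definition pt0 : 'I_(3 + d) := lshift d (@Ordinal 3 0 isT).
Definition pt1 : 'I_(3 + d) := lshift d (@Ordinal 3 1 isT).
Definition ptoo : 'I_(3 + d) := lshift d (@Ordinal 3 2 isT).

Lemma zpt0 lam : zpt lam pt0 = Some 0.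
Proof. by rewrite /zpt /pt0 (unsplitK (inl _)). Qed.
Lemma zpt1 lam : zpt lam pt1 = Some 1.
Proof. by rewrite /zpt /pt1 (unsplitK (inl _)). Qed.
Lemma zptoo lam : zpt lam ptoo = None.
Proof. by rewrite /zpt /ptoo (unsplitK (inl _)). Qed.
Lemma zptr lam k : zpt lam (rshift 3 k) = Some (lam 0 k).
Proof. by rewrite /zpt (unsplitK (inr _)). Qed.

Lemma config_ind (P : 'I_(3 + d) -> Prop) :
  P pt0 -> P pt1 -> P ptoo -> (forall k, P (rshift 3 k)) -> forall i, P i.
Proof.
move=> P0 P1 Poo Pr i; case: (splitP i) => [j|k] ij.
  have -> : i = lshift d j by apply: val_inj.
  by case: j {ij} => -[|[|[|//]]] h; [move: P0|move: P1|move: Poo]; congr P; apply: val_inj.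
by have -> : i = rshift 3 k by apply: val_inj.
Qed.

Lemma pt_neq : [/\ pt0 != pt1, pt1 != ptoo & pt0 != ptoo].
Proof. by split; rewrite -val_eqE. Qed.

Lemma Kn_zpt lam : Kn lam <-> injective (zpt lam).
Proof.
split=> [[l01 ll] i j|inj].
  elim/config_ind: i => [|||k]; elim/config_ind: j => [|||m]; rewrite ?(zpt0,zpt1,zptoo,zptr) //.
  - by case=> /esym/eqP; rewrite oner_eq0.
  - by case=> /esym/eqP; have [/negPf->] := l01 m.
  - by case=> /eqP; rewrite oner_eq0.
  - by case=> /esym/eqP; have [_ /negPf->] := l01 m.
  - by case=> /eqP; have [/negPf->] := l01 k.
  - by case=> /eqP; have [_ /negPf->] := l01 k.
  - by case: (eqVneq k m) => [->//|/ll /eqP h] [].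
split=> [k|k m km].
  split; apply/eqP=> h.
    by have := inj pt0 (rshift 3 k); rewrite zpt0 zptr h => /(_ erefl) /(congr1 val).
  by have := inj pt1 (rshift 3 k); rewrite zpt1 zptr h => /(_ erefl) /(congr1 val).
apply: contraNneq km => h; apply/eqP/(@rshift_inj 3 d)/inj.
by rewrite !zptr h.
Qed.

(** The LFT that moves the first three points to 0, 1, infinity; the coordinates of
    the remaining points give the configuration in K_n equivalent to [z]. *)
Definition normalizer (z : 'I_(3 + d) -> sphere R) := to01oo (z pt0) (z pt1) (z ptoo).
Definition normalized (z : 'I_(3 + d) -> sphere R) : E :=
  \row_k odflt 0 (normalizer z (z (rshift 3 k))).

Lemma injective_pt3 (z : 'I_(3 + d) -> sphere R) : injective z ->
  [/\ z pt0 <> z pt1, z pt1 <> z ptoo & z pt0 <> z ptoo].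
Proof. by move=> zi; have [/eqP h1 /eqP h2 /eqP h3] := pt_neq; split=> /zi. Qed.

Lemma normalizedP z : injective z ->
  [/\ is_lft (normalizer z), Kn (normalized z)
    & forall i, zpt (normalized z) i = normalizer z (z i)].
Proof.
move=> zi; have [h1 h2 h3] := injective_pt3 zi.
have lf : is_lft (normalizer z) by apply: is_lft_to01oo.
have [f0 f1 f2] := to01oo_spec h1 h2 h3.
have E1 i : zpt (normalized z) i = normalizer z (z i).
  elim/config_ind: i => [|||k]; rewrite ?(zpt0,zpt1,zptoo) //.
  rewrite zptr mxE; case E : (normalizer z _) => [x|] //.
  have /zi/(congr1 val)/= : z (rshift 3 k) = z ptoo by apply: (lft_inj lf); rewrite E.
  by move/eqP; lia.
split=> //; apply/Kn_zpt => i j; rewrite !E1.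
by move/(lft_inj lf)/zi.
Qed.

Lemma fmapE s lam : Kn lam -> fmap s lam = normalizer (fun i => zpt lam ((s^-1)%g i)).
Proof.
move=> /Kn_zpt zi; have zi' : injective (fun i => zpt lam ((s^-1)%g i)).
  by move=> i j /zi /perm_inj.
have [h1 h2 h3] := injective_pt3 zi'.
by rewrite /fmap lft_to_01ooE.
Qed.

Lemma gmapE s lam : Kn lam -> gmap s lam = normalized (fun i => zpt lam ((s^-1)%g i)).
Proof. by move=> kl; rewrite /gmap /patch mem_set // fmapE. Qed.

Lemma gmap_out s lam : ~ Kn lam -> gmap s lam = lam.
Proof. by move=> kl; rewrite /gmap /patch memNset. Qed.

Lemma gmapP s lam : Kn lam -> [/\ is_lft (fmap s lam), Kn (gmap s lam) &
  forall i, zpt (gmap s lam) (s i) = fmap s lam (zpt lam i)].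
Proof.
move=> kl; rewrite fmapE // gmapE //.
have [|h1 h2 h3] := @normalizedP (fun i => zpt lam ((s^-1)%g i)).
  by move/Kn_zpt : kl => zi i j /zi /perm_inj.
by split=> // i; rewrite h3 permK.
Qed.

Lemma zpt_inj lam mu : (forall i, zpt lam i = zpt mu i) -> lam = mu.
Proof. by move=> h; apply/rowP=> k; have := h (rshift 3 k); rewrite !zptr => -[]. Qed.

(** An LFT that carries one normalized configuration to another after relabelling
    is unique, so it identifies the value of [gmap]. *)
Lemma gmap_unique s lam mu f : Kn lam -> Kn mu -> is_lft f ->
  (forall i, zpt mu (s i) = f (zpt lam i)) -> fmap s lam = f /\ gmap s lam = mu.
Proof.
move=> kl km lf h; have [lf' kg hg] := gmapP s kl.
have zi : injective (fun i => zpt lam ((s^-1)%g i)).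
  by move/Kn_zpt : kl => zi i j /zi /perm_inj.
have [h1 h2 h3] := injective_pt3 zi.
have fE : fmap s lam = f.
  by apply: (lft_eq3 lf' lf h1 h2 h3); rewrite -hg -h permKV ?zpt0 ?zpt1 ?zptoo.
split=> //; apply: zpt_inj => i.
by rewrite -(permKV s i) hg h fE.
Qed.

Lemma gmap_comp s t : gmap s \o gmap t = gmap (t * s)%g :> (E -> E).
Proof.
apply/funext=> lam /=; have [kl|kl] := pselect (Kn lam); last by rewrite !gmap_out.
have [lt kt ht] := gmapP t kl; have [ls ks hs] := gmapP s kt.
have [|_ ->//] := gmap_unique (s := (t * s)%g) kl ks (is_lft_comp ls lt).
by move=> i; rewrite permM hs ht.
Qed.

Lemma gmap1 : gmap 1 = id :> (E -> E).
Proof.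
apply/funext=> lam /=; have [kl|kl] := pselect (Kn lam); last by rewrite !gmap_out.
by have [|_ ->//] := gmap_unique (s := 1%g) kl kl (@is_lft_id R) => i; rewrite perm1.
Qed.

(** The sphere is infinite: a real number that exceeds all norms works. *)
Lemma exists_new_point lam : exists w, forall i, zpt lam i <> w.
Proof.
(* The summand 2 keeps the point away from 0 and 1. *)
pose x := 2 + \sum_k `|lam 0 k|.
have sge0 : 0 <= \sum_k `|lam 0 k| by apply: sumr_ge0 => k _; apply: normr_ge0.
have x2 : 2 <= x by rewrite /x lerDl.
exists (Some x) => i; elim/config_ind: i => [|||k]; rewrite ?(zpt0,zpt1,zptoo,zptr) //.
- by case=> x0; move: x2; rewrite -x0 lern0.
- by case=> x0; move: x2; rewrite -x0 (ler_nat R[i] 2 1).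
case=> xk; have : `|x| <= `|lam 0 k| by rewrite xk.
rewrite ger0_norm; last exact: le_trans (ler0n _ 2) x2.
rewrite /x (bigD1 k) //= addrCA gerDl => h.
have h0 : 0 <= \sum_(i < d | i != k) `|lam 0 i| by apply: sumr_ge0 => j _; apply: normr_ge0.
by have := le_trans (ler_wpDr h0 (lexx 2)) h; rewrite lern0.
Qed.

(** Suppose [s] moves [i], and let [j = s i].  The LFT that realises [s] on the
    configuration and the one that realises it after the [j]-th point has been moved
    to a new position [w] agree at all points except those of index [i] and [j].
    There are at least three other points, so the two LFTs are equal; but they send
    the [i]-th point to different places. *)
Lemma gmap_faithful1 lam s : (2 <= d)%N -> Kn lam -> gmap s = id :> (E -> E) -> s = 1%g.
Proof.
move=> d2 kl gs; apply/permP => i; rewrite perm1; apply/eqP/negPn/negP => /eqP sij.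
have [w wl] := exists_new_point lam; have zi := (Kn_zpt lam).1 kl.
set j := s i in sij.
pose z' a := if a == j then w else zpt lam a.
have z'i : injective z'.
  by move=> a b; rewrite /z'; case: eqP => [->|_]; case: eqP => [->|_] //;
    [move/esym/wl|move/wl|move/zi].
have [lf _ hf] := gmapP s kl; rewrite gs in hf.
have [lh km hm] := normalizedP z'i.
have [lf' _ hf'] := gmapP s km; rewrite gs in hf'.
have [h' [lh' hh' h'h]] := is_lft_inv lh.
(* f' realises s on the configuration z', which is not normalized. *)
pose f' := h' \o (fmap s (normalized z') \o normalizer z').
have f'E a : f' (z' a) = z' (s a) by rewrite /f' /= -hm -hf' hm hh'.
have lf2 : is_lft f' by exact: (is_lft_comp lh' (is_lft_comp lf' lh)).
have /card_gt2P[a [b [c [[ha hb hc] [ab bc ca]]]]] : (2 < #|[set~ i] :\ j|)%N.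
  have := cardsD1 j [set~ i]; rewrite cardsC1 card_ord; case: (_ \in _) => /=; lia.
have ff a' : a' \in [set~ i] :\ j -> fmap s lam (zpt lam a') = f' (zpt lam a').
  rewrite !inE => /andP[aj ai].
  have -> : zpt lam a' = z' a' by rewrite /z' (negPf aj).
  rewrite f'E {1}/z' (negPf aj) -hf /z'; case: eqP => // /perm_inj ai'.
  by rewrite ai' eqxx in ai.
have zne x y : x != y -> zpt lam x <> zpt lam y by move=> /eqP h /zi.
have fE := lft_eq3 lf lf2 (zne _ _ ab) (zne _ _ bc) (nesym (zne _ _ ca)) (ff _ ha) (ff _ hb)
  (ff _ hc).
have := f'E i; rewrite -fE /z' eqxx; case: eqP => [ij|_]; first by case: sij.
by rewrite -hf => /wl.
Qed.

Lemma gmap_inj lam : (2 <= d)%N -> Kn lam -> injective (fun s : 'S_(3 + d) => gmap s : E -> E).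
Proof.
move=> d2 kl s t /= st; have : (s * t^-1)%g = 1%g.
  by apply: (gmap_faithful1 d2 kl); rewrite -gmap_comp st gmap_comp mulgV gmap1.
by move/eqP; rewrite -eq_mulgV1 => /eqP.
Qed.

End Normalization.

(** * The derivative of g_sigma *)

Lemma quotient_rule (K : fieldType) (N D N' D' : K) : D != 0 ->
  N * (- D ^- 2 * D') + D^-1 * N' = (D * N' - N * D') / D ^+ 2.
Proof. by move=> D0; field. Qed.

(** [P] preserves the image of [V], a [k]-dimensional subspace complementary to the
    last [d] coordinates, and acts on it by [S]; [X] is the endomorphism induced
    on the quotient, represented on these coordinates.  Traces are additive. *)
Lemma trace_quotient (K : fieldType) k d (P : 'M[K]_(k + d)) (V : 'M_(k + d, k))
    (S : 'M_k) (X : 'M_d) (Q : 'M_(k, d)) :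
  usubmx V \in unitmx -> P *m V = V *m S ->
  col_mx 0 X = P *m col_mx 0 1%:M - V *m Q -> \tr X = \tr P - \tr S.
Proof.
rewrite -[P]submxK -[V]vsubmxK col_mxKu.
move: (usubmx V) (dsubmx V) (ulsubmx P) (ursubmx P) (dlsubmx P) (drsubmx P).
move=> V1 V2 P11 P12 P21 P22 V1u.
rewrite !mul_block_col !mulmx0 !add0r !mulmx1 !mul_col_mx opp_col_mx add_col_mx.
move=> /eq_col_mx [PV _] /eq_col_mx [/esym/eqP]; rewrite subr_eq0 => /eqP PQ ->.
rewrite mxtrace_block linearB /= mxtrace_mulC.
have -> : \tr (Q *m V2) = \tr S - \tr P11; last by ring.
have /(congr1 (mulmx (invmx V1))) := PV; rewrite PQ mulmxDr -!mulmxA !mulKmx //.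
move/(congr1 mxtrace); rewrite mxtraceD mxtrace_mulC -mulmxA mulmxV // mulmx1 => <-.
by ring.
Qed.

(** Differentiability is local.  This serves because [gmap] is given by a rational
    formula only on the open set [Kn]. *)
Lemma differentiable_near_eq (K : numFieldType) (V W : normedModType K) (f g : V -> W) (x : V) :
  (\near x, f x = g x) -> differentiable f x ->
  differentiable g x /\ 'd g x = 'd f x :> (V -> W).
Proof.
move=> fg df; have [dfc dfx] := (diff_locallyP x f).1 df.
have gx : g \o shift x = cst (g x) + 'd f x +o_ 0 id.
  apply/eqaddoP => e e0; move: dfx => /eqaddoP /(_ e e0) dfx.
  have fg0 : \forall h \near 0, f (h + x) = g (h + x).
    by have := fg; rewrite (near_shift 0) subr0.
  near=> h.
  rewrite !fctE /= -(near fg0 h) // -(nbhs_singleton fg).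
  by near: h; exact: dfx.
have E := diff_unique dfc gx.
split; last exact: E.
by apply/diff_locallyP; rewrite E; split; [exact: dfc | exact: gx].
Unshelve. all: by end_near. Qed.

Section Jacobian.
Variables (R : realType) (d : nat).
Let K : numFieldType := R[i].
Notation E := 'rV[K]_d.
Implicit Types (lam mu v : E) (s t : 'S_(3 + d)).

(** K_n is open: it is defined by finitely many inequations between continuous
    functions. *)
Lemma near_Kn lam : Kn lam -> \forall mu \near lam, Kn mu.
Proof.
move=> [l01 ll].
have nz (f : E -> K) : differentiable f lam -> f lam != 0 -> \forall mu \near lam, f mu != 0.
  by move=> /differentiable_continuous fc f0; exact: (cvgr_neq0 (f lam) fc f0).
have cc k : differentiable (fun mu : E => mu 0 k) lam by apply: differentiable_coord.
have near1 : nbhs lam (fun mu : E => forall i : 'I_d, mu 0 i != 0 /\ mu 0 i != 1).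
  apply: (@filter_forall E _ (fun (i : 'I_d) (mu : E) => mu 0 i != 0 /\ mu 0 i != 1)
    (nbhs lam) (nbhs_filter lam)) => i.
  have [h0 h1] := l01 i.
  have n0 := nz _ (cc i) h0.
  have n1 : nbhs lam (fun mu : E => mu 0 i - 1 != 0).
    apply: (nz (fun mu : E => mu 0 i - 1)); last by rewrite subr_eq0.
    by apply: differentiableB (cc i) _.
  by near=> mu; split; [near: mu | rewrite -subr_eq0; near: mu].
have near2 : nbhs lam (fun mu : E => forall i j : 'I_d, i != j -> mu 0 i != mu 0 j).
  apply: (@filter_forall E _ (fun (i : 'I_d) (mu : E) => forall j, i != j -> mu 0 i != mu 0 j)
    (nbhs lam) (nbhs_filter lam)) => i.
  apply: (@filter_forall E _ (fun (j : 'I_d) (mu : E) => i != j -> mu 0 i != mu 0 j)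
    (nbhs lam) (nbhs_filter lam)) => j.
  have [ij|ij] := eqVneq i j; first by near=> mu.
  have n1 : nbhs lam (fun mu : E => mu 0 i - mu 0 j != 0).
    apply: (nz (fun mu : E => mu 0 i - mu 0 j)); last by rewrite subr_eq0 ll.
    exact: differentiableB (cc i) (cc j).
  by near=> mu => _; rewrite -subr_eq0; near: mu.
by near=> mu; split; near: mu.
Unshelve. all: by end_near. Qed.

(** A tangent vector of K_n as a displacement of all the points: 0, 1 and infinity
    do not move. *)
Definition extend0 v (i : 'I_(3 + d)) : K := if fintype.split i is inr k then v 0 k else 0.

Lemma extend0_l v (j : 'I_3) : extend0 v (lshift d j) = 0.
Proof. by rewrite /extend0 (unsplitK (inl _)). Qed.
Lemma extend0_r v k : extend0 v (rshift 3 k) = v 0 k.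
Proof. by rewrite /extend0 (unsplitK (inr _)). Qed.

Lemma coord_linear k : exists2 f : {linear E -> K}, continuous f & f = (fun N => N 0 k) :> (E -> K).
Proof.
have @f : {linear E -> K}.
  by exists (fun N : E => N 0 k); do 2![eexists]; do ?[constructor];
     rewrite ?mxE// => ? *; rewrite ?mxE//; move=> ?; rewrite !mxE.
by exists f => //; exact: coord_continuous.
Qed.

Definition xcoord mu i : K := hom_x (zpt mu i).
Definition ycoord mu i : K := hom_y (zpt mu i).
Definition bracket i j mu : K := xcoord mu i * ycoord mu j - xcoord mu j * ycoord mu i.

Lemma diff_xcoord lam i : differentiable (xcoord^~ i) lam /\
  forall v, 'd (xcoord^~ i) lam v = extend0 v i.
Proof.
have cst_case (x : K) : extend0^~ i = cst 0 -> xcoord^~ i = cst x ->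
    differentiable (xcoord^~ i) lam /\ forall v, 'd (xcoord^~ i) lam v = extend0 v i.
  move=> ei ->; split; first exact: differentiable_cst.
  by move=> v; rewrite diff_cst; have /(congr1 (fun f => f v)) := ei.
have exl (j : 'I_3) : extend0^~ (lshift d j) = cst 0 by apply/funext=> v; rewrite extend0_l.
elim/config_ind: i cst_case => [cs|cs|cs|k _].
- by apply: (cs 0 (exl _)); apply/funext=> mu; rewrite /xcoord zpt0.
- by apply: (cs 1 (exl _)); apply/funext=> mu; rewrite /xcoord zpt1.
- by apply: (cs 1 (exl _)); apply/funext=> mu; rewrite /xcoord zptoo.
have -> : xcoord^~ (rshift 3 k) = (fun mu => mu 0 k) by apply/funext=> mu; rewrite /xcoord zptr.
split; first exact: differentiable_coord.
move=> v; rewrite extend0_r /=.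
have [f fc fE] := coord_linear k.
by rewrite -fE diff_lin // fE.
Qed.

(** The second homogeneous coordinate is 1 or 0 according to the index alone, so
    only the first coordinates vary with the configuration. *)
Lemma ycoord_cst lam mu i : ycoord mu i = ycoord lam i.
Proof. by rewrite /ycoord; elim/config_ind: i => *; rewrite !(zpt0,zpt1,zptoo,zptr). Qed.

Definition dbracket lam v i j : K := extend0 v i * ycoord lam j - extend0 v j * ycoord lam i.

Lemma diff_bracket lam i j : differentiable (bracket i j) lam /\
  forall v, 'd (bracket i j) lam v = dbracket lam v i j.
Proof.
have [di hi] := diff_xcoord lam i; have [dj hj] := diff_xcoord lam j.
have -> : bracket i j = ycoord lam j *: (xcoord^~ i) - ycoord lam i *: (xcoord^~ j).
  apply/funext => mu; rewrite !fctE /bracket !(ycoord_cst lam mu) /GRing.scale /=.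
  by congr (_ - _); exact: mulrC.
split; first by apply: differentiableB; apply: differentiableZ.
move=> v.
have e1 := congr1 (fun h : E -> K => h v) (diffZ (ycoord lam j) di).
have e2 := congr1 (fun h : E -> K => h v) (diffZ (ycoord lam i) dj).
have e3 := congr1 (fun h : E -> K => h v)
  (diffB (differentiableZ (ycoord lam j) di) (differentiableZ (ycoord lam i) dj)).
transitivity (ycoord lam j * 'd (xcoord^~ i) lam v - ycoord lam i * 'd (xcoord^~ j) lam v).
  rewrite [LHS]e3.
  exact: (congr2 (fun a b => a - b) e1 e2).
apply: (etrans (congr2 (fun a b => ycoord lam j * a - ycoord lam i * b) (hi v) (hj v))).
by congr (_ - _); exact: mulrC.
Qed.

Lemma diff_bracketM lam i j k l v : 'd (bracket i j * bracket k l) lam v =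
  bracket i j lam * dbracket lam v k l + bracket k l lam * dbracket lam v i j.
Proof.
have [d1 h1] := diff_bracket lam i j; have [d2 h2] := diff_bracket lam k l.
apply: (etrans (congr1 (fun h : E -> K => h v) (diffM d1 d2))).
exact: (congr2 (fun a b => bracket i j lam * a + bracket k l lam * b) (h2 v) (h1 v)).
Qed.

(** Numerator and denominator of the cross-ratio that gives the [k]-th coordinate of
    [gmap s]. *)
Definition gnum s k : E -> K :=
  bracket ((s^-1)%g (rshift 3 k)) ((s^-1)%g (pt0 d)) *
  bracket ((s^-1)%g (pt1 d)) ((s^-1)%g (ptoo d)).
Definition gden s k : E -> K :=
  bracket ((s^-1)%g (rshift 3 k)) ((s^-1)%g (ptoo d)) *
  bracket ((s^-1)%g (pt1 d)) ((s^-1)%g (pt0 d)).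

Lemma bracket_neq0 mu i j : Kn mu -> i != j -> bracket i j mu != 0.
Proof. by move=> /Kn_zpt zi /eqP ij; apply: sphere_bracket_neq0 => /zi. Qed.

Lemma gden_neq0 s k mu : Kn mu -> gden s k mu != 0.
Proof.
move=> km; rewrite mulf_neq0 // bracket_neq0 // (inj_eq perm_inj) -val_eqE //=.
Qed.

Lemma gmap_coord s k mu : Kn mu -> gmap s mu 0 k = gnum s k mu / gden s k mu.
Proof.
move=> km; have := gden_neq0 s k km; rewrite gmapE // mxE /normalizer to01ooE /of_hom.
by rewrite /gnum /gden /= => /negPf; rewrite /bracket /xcoord /ycoord => ->.
Qed.

Lemma diff_gmap s lam : Kn lam -> differentiable (gmap s) lam /\
  forall v k, ('d (gmap s) lam v) 0 k =
    (gden s k lam * 'd (gnum s k) lam v - gnum s k lam * 'd (gden s k) lam v) / gden s k lam ^+ 2.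
Proof.
move=> kl.
have dn k : differentiable (gnum s k) lam.
  by apply: differentiableM; apply: (diff_bracket _ _ _).1.
have dd k : differentiable (gden s k) lam.
  by apply: differentiableM; apply: (diff_bracket _ _ _).1.
have dv k : differentiable (fun mu => (gden s k mu)^-1) lam.
  by apply: differentiableV => //; apply: gden_neq0.
pose G k : E -> K := gnum s k * (fun mu => (gden s k mu)^-1).
have dG k : differentiable (G k) lam by apply: differentiableM.
pose GG : E -> E := \sum_(k < d) (fun mu => G k mu *: delta_mx 0 k).
have dGG : differentiable GG lam.
  by apply: differentiable_sum => k; apply: differentiableZl.
(* The rational formula GG agrees with gmap s near lam only, not everywhere. *)
have nG : \near lam, GG lam = gmap s lam.
  near=> mu; have km : Kn mu by near: mu; apply: near_Kn.
  apply/rowP => k; rewrite gmap_coord // /GG fct_sumE summxE (bigD1 k) //= big1.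
    by rewrite !mxE !eqxx mulr1 addr0.
  by move=> j jk; rewrite !mxE eq_sym (negPf jk) andbF mulr0.
have [dg dgE] := differentiable_near_eq nG dGG.
split; first exact: dg.
move=> v k.
have [f fc fE] := coord_linear k.
have e1 := congr1 (fun h : E -> K => h v) (diff_comp dg (linear_differentiable (gmap s lam) fc)).
have e2 := congr1 (fun h : E -> K => h ('d (gmap s) lam v)) (diff_lin (gmap s lam) fc).
have nk : \near lam, G k lam = (f \o gmap s) lam.
  near=> mu; have km : Kn mu by near: mu; apply: near_Kn.
  by rewrite /= fE gmap_coord.
have [_ e3] := differentiable_near_eq nk (dG k).
have {}e3 := congr1 (fun h : E -> K => h v) e3.
have e4 := congr1 (fun h : E -> K => h v) (diffM (dn k) (dv k)).
have e5 := congr1 (fun h : E -> K => h v) (diffV (dd k) (gden_neq0 s k kl)).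
apply: (etrans (esym (congr1 (fun h : E -> K => h ('d (gmap s) lam v)) fE)));
  apply: (etrans (esym e2)); apply: (etrans (esym e1)); apply: (etrans e3); apply: (etrans e4).
apply: (etrans (congr2 (fun a b => gnum s k lam * a + (gden s k lam)^-1 * b) e5 erefl)).
exact: quotient_rule (gden_neq0 s k kl).
Unshelve. all: by end_near. Qed.
End Jacobian.

(** * The trace of the Jacobian at a fixed configuration *)

Section Adjugate.
Variable K : fieldType.
Implicit Types x y c : K.

(** Cramer's rule for a matrix that sends [(x, y)] to [c] times [(X, Y)]. *)
Lemma adj_vec f1 f2 f3 f4 x y c (X Y : K) : f1 * f4 - f2 * f3 != 0 ->
  f1 * x + f2 * y = c * X -> f3 * x + f4 * y = c * Y ->
  x = c * (f4 * X - f2 * Y) / (f1 * f4 - f2 * f3) /\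
  y = c * (f1 * Y - f3 * X) / (f1 * f4 - f2 * f3).
Proof.
move=> D h1 h2; split; apply: (mulIf D); rewrite divfK //.
  by transitivity (f4 * (c * X) - f2 * (c * Y)); [rewrite -h1 -h2; ring | ring].
by transitivity (f1 * (c * Y) - f3 * (c * X)); [rewrite -h1 -h2; ring | ring].
Qed.

(** Differentiate [F w = c W], where [F] varies with derivative [G], [w = (x, y)]
    moves by [(x', 0)] and [W = (X, Y)].  The determinant of [F w] and of its
    derivative [G w + F (x', 0)], which measures the displacement of the image
    point, is the sum of [- det F * (y * x')], the transported displacement of [w],
    and of det(F w, G w).  Writing [w] through [W] with [adj_vec] turns the latter
    into a quadratic form in [W], that is a global vector field. *)
Lemma variation_identity f1 f2 f3 f4 g1 g2 g3 g4 x y c (X Y x' : K) :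
  let D := f1 * f4 - f2 * f3 in D != 0 ->
  f1 * x + f2 * y = c * X -> f3 * x + f4 * y = c * Y ->
  (c * X) * (g3 * x + g4 * y + f3 * x') - (c * Y) * (g1 * x + g2 * y + f1 * x') =
  c ^+ 2 * ((g3 * f4 - g4 * f3) / D * X ^+ 2 +
            ((g4 * f1 - g3 * f2) / D - (g1 * f4 - g2 * f3) / D) * (X * Y) -
            (g2 * f1 - g1 * f2) / D * Y ^+ 2) - D * (y * x').
Proof.
move=> D D0 h1 h2; have [xE yE] := adj_vec D0 h1 h2.
rewrite -/D in xE yE; rewrite xE yE /D; field.
exact: D0.
Qed.
End Adjugate.

(** The matrix with rows [(a, b)] and [(c, e)] permutes the points of [lam] according
    to [s], acting on the coordinate vectors with multipliers [k].  At a fixed point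
    [i] of [s], the derivative of the LFT is [(a * e - b * c) / k i ^+ 2]. *)
Definition carries (R : realType) (d : nat) (lam : 'rV[R[i]]_d) (s : 'S_(3 + d))
    (a b c e : R[i]) (k : 'I_(3 + d) -> R[i]) :=
  a * e - b * c != 0 /\ forall i, [/\ k i != 0,
    a * hom_x (zpt lam i) + b * hom_y (zpt lam i) = k i * hom_x (zpt lam (s i)) &
    c * hom_x (zpt lam i) + e * hom_y (zpt lam i) = k i * hom_y (zpt lam (s i))].

Section TraceFormula.
Variables (R : realType) (d : nat).
Let K : numFieldType := R[i].
Notation E := 'rV[K]_d.
Variables (lam : E) (s : 'S_(3 + d)).
Hypotheses (kl : Kn lam) (gl : gmap s lam = lam).

Let u : 'I_(3 + d) := (s^-1)%g (pt0 d).
Let v : 'I_(3 + d) := (s^-1)%g (pt1 d).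
Let w : 'I_(3 + d) := (s^-1)%g (ptoo d).
Let x i : K := xcoord lam i.
Let y i : K := ycoord lam i.
Let B i j : K := bracket i j lam.

(* The matrix of the cross-ratio of the points that are sent to 0, 1, oo. *)
Let f1 : K := B v w * y u.
Let f2 : K := - (B v w * x u).
Let f3 : K := B v u * y w.
Let f4 : K := - (B v u * x w).
Let D : K := f1 * f4 - f2 * f3.

Let D_neq0 : D != 0.
Proof.
have -> : D = B v w * B v u * B u w.
  by rewrite /D /f1 /f2 /f3 /f4 /B /bracket /x /y; ring.
by rewrite !mulf_neq0 // bracket_neq0 // (inj_eq perm_inj) -val_eqE.
Qed.

Lemma exists_multipliers : exists c, carries lam s f1 f2 f3 f4 c.
Proof.
have : forall i, exists c : K, [/\ c != 0, f1 * x i + f2 * y i = c * x (s i) &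
    f3 * x i + f4 * y i = c * y (s i)].
  move=> i; have [_ _ h] := gmapP s kl; rewrite gl in h.
  have := h i; rewrite fmapE // /normalizer /to01oo => si.
  have [c c0 [h1 h2]] := lft_vec (zpt lam i) D_neq0.
  by exists c; split=> //; rewrite /x /xcoord /y /ycoord si.
by move=> /fin_all_exists [c hc]; exists c; split.
Qed.

Let carriesE c : carries lam s f1 f2 f3 f4 c -> forall i,
  [/\ c i != 0, f1 * x i + f2 * y i = c i * x (s i) & f3 * x i + f4 * y i = c i * y (s i)].
Proof. by case. Qed.

(* Primed quantities are derivatives in the direction t. *)
Variable t : E.
Let x' i : K := extend0 t i.
Let B' i j : K := dbracket lam t i j.
(* The image of the i-th point is N i / M i. *)
Let N i := B i u * B v w.
Let N' i := B' i u * B v w + B i u * B' v w.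
Let M i := B i w * B v u.
Let M' i := B' i w * B v u + B i w * B' v u.

(** The quotient rule for the free points; for those that are sent to 0, 1, infinity,
    both sides vanish. *)
Lemma ext_dgmap c : carries lam s f1 f2 f3 f4 c -> forall i,
  extend0 ('d (gmap s) lam t) (s i) = (M i * N' i - N i * M' i) / c i ^+ 2.
Proof.
move=> /carriesE hc i; have [c0 h1 h2] := hc i.
have NE : N i = c i * x (s i).
  by rewrite -h1 /N /f1 /f2 /B /bracket /x /y; ring.
have ME : M i = c i * y (s i).
  by rewrite -h2 /M /f3 /f4 /B /bracket /x /y; ring.
have [j ij] : exists j, i = (s^-1)%g j by exists (s i); rewrite permK.
rewrite ij permKV; rewrite ij permKV in NE ME.
have B0 a : B a a = 0 by rewrite /B /bracket subrr.
have B'0 a : B' a a = 0 by rewrite /B' /dbracket subrr.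
move: c0; elim/config_ind: j ij NE ME => [|||k] ij NE ME c0.
- by rewrite extend0_l /N /N' -/u B0 B'0 !mul0r addr0 mulr0 subr0 mul0r.
- rewrite extend0_l /N /N' /M /M' -/v.
  suff -> : B v w * B v u * (B' v u * B v w + B v u * B' v w) -
            B v u * B v w * (B' v w * B v u + B v w * B' v u) = 0 by rewrite mul0r.
  by ring.
- by rewrite extend0_l /M /M' -/w B0 B'0 !mul0r addr0 mulr0 subr0 mul0r.
rewrite extend0_r (diff_gmap s kl).2.
have gM : gden s k lam = M ((s^-1)%g (rshift 3 k)) by [].
have yk : y (rshift 3 k) = 1 by rewrite /y /ycoord zptr.
rewrite yk mulr1 in ME.
have gN' : 'd (gnum s k) lam t = N' ((s^-1)%g (rshift 3 k)).
  by apply: (etrans (diff_bracketM _ _ _ _ _ _)); rewrite /N' addrC [X in X + _]mulrC.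
have gM' : 'd (gden s k) lam t = M' ((s^-1)%g (rshift 3 k)).
  by apply: (etrans (diff_bracketM _ _ _ _ _ _)); rewrite /M' addrC [X in X + _]mulrC.
apply: (etrans (congr2 (fun a b => (gden s k lam * a
  - gnum s k lam * b) / gden s k lam ^+ 2) gN' gM')).
by rewrite -ME.
Qed.

(* The derivative of the matrix (f1, f2; f3, f4) in the direction t. *)
Let g1 : K := B' v w * y u.
Let g2 : K := - (B' v w * x u + B v w * x' u).
Let g3 : K := B' v u * y w.
Let g4 : K := - (B' v u * x w + B v u * x' w).

(** The displacement of the image points is the image of the displacement under
    the derivative of the LFT, corrected by a global vector field that brings 0, 1
    and infinity back to rest. *)
Lemma ext_dgmap_quadratic c : carries lam s f1 f2 f3 f4 c -> exists q0 q1 q2 : K, forall i,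
  extend0 ('d (gmap s) lam t) (s i) = D / c i ^+ 2 * x' i -
    (q0 * x (s i) ^+ 2 + q1 * (x (s i) * y (s i)) + q2 * y (s i) ^+ 2).
Proof.
move=> hcarries; have hc := carriesE hcarries.
exists ((g3 * f4 - g4 * f3) / D), ((g4 * f1 - g3 * f2) / D - (g1 * f4 - g2 * f3) / D),
  (- ((g2 * f1 - g1 * f2) / D)) => i.
rewrite (ext_dgmap hcarries); have [c0 h1 h2] := hc i.
have yx : y i * x' i = x' i.
  rewrite /y /ycoord /x'; elim/config_ind: (i) => [|||k];
  by rewrite ?extend0_l ?mulr0 // zptr mul1r.
have := variation_identity g1 g2 g3 g4 (x' i) D_neq0 h1 h2; rewrite yx.
have NE : N i = c i * x (s i).
  by rewrite -h1 /N /f1 /f2 /B /bracket /x /y; ring.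
have ME : M i = c i * y (s i).
  by rewrite -h2 /M /f3 /f4 /B /bracket /x /y; ring.
have -> : g3 * x i + g4 * y i + f3 * x' i = M' i.
  by rewrite /g3 /g4 /f3 /M' /B /bracket /B' /dbracket -!/(x _) -!/(y _) -!/(x' _) /x /y; ring.
have -> : g1 * x i + g2 * y i + f1 * x' i = N' i.
  by rewrite /g1 /g2 /f1 /N' /B /bracket /B' /dbracket -!/(x _) -!/(y _) -!/(x' _) /x /y; ring.
rewrite -NE -ME -/D => var.
have -> : M i * N' i - N i * M' i = - (N i * M' i - M i * N' i) by ring.
rewrite var; move: (x (s i)) (y (s i)) (x' i) (_ / D) (_ / D) (_ / D) (_ / D).
move=> X Y x1 a1 a2 a3 a4.
by field.
Qed.
End TraceFormula.

Section TraceJacobian.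
Variables (R : realType) (d : nat).
Let K : numFieldType := R[i].
Notation E := 'rV[K]_d.
Implicit Types (lam : E) (s : 'S_(3 + d)).

Lemma jacobian_structure lam s : Kn lam -> gmap s lam = lam ->
  exists a b c e k, carries lam s a b c e k /\
    forall t : E, exists q0 q1 q2 : K, forall i,
      extend0 ('d (gmap s) lam t) (s i) = (a * e - b * c) / k i ^+ 2 * extend0 t i -
        (q0 * xcoord lam (s i) ^+ 2 + q1 * (xcoord lam (s i) * ycoord lam (s i)) +
          q2 * ycoord lam (s i) ^+ 2).
Proof.
move=> kl gl; have [k hk] := exists_multipliers kl gl.
do 4!eexists; exists k; split; first exact: hk.
by move=> t; exact: (ext_dgmap_quadratic kl t hk).
Qed.

(** Two matrices that permute the points in the same way differ by a matrix with
    0, 1 and infinity among its eigenlines, hence by a scalar. *)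
Lemma carries_unique lam s a b c e k a' b' c' e' k' :
  carries lam s a b c e k -> carries lam s a' b' c' e' k' ->
  exists2 z, z != 0 & [/\ a' = z * a, b' = z * b, c' = z * c & e' = z * e].
Proof.
move=> [D h] [D' h'].
have G i : exists g : R[i],
    (b' * - c + a' * e) * hom_x (zpt lam i) + (b' * a - a' * b) * hom_y (zpt lam i) =
      g * hom_x (zpt lam i) /\
    (e' * - c + c' * e) * hom_x (zpt lam i) + (e' * a - c' * b) * hom_y (zpt lam i) =
      g * hom_y (zpt lam i).
  have [k0 h1 h2] := h ((s^-1)%g i); have [k0' h1' h2'] := h' ((s^-1)%g i).
  rewrite permKV in h1 h2 h1' h2'.
  have [xE yE] := adj_vec D h1 h2.
  exists ((a * e - b * c) * k' ((s^-1)%g i) / k ((s^-1)%g i)).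
  move: h1' h2'; rewrite xE yE => h1' h2'.
  split.
    transitivity ((a * e - b * c) / k ((s^-1)%g i) * (k' ((s^-1)%g i) * hom_x (zpt lam i))).
      by rewrite -h1'; field; rewrite k0 D.
    by field; exact: k0.
  transitivity ((a * e - b * c) / k ((s^-1)%g i) * (k' ((s^-1)%g i) * hom_y (zpt lam i))).
    by rewrite -h2'; field; rewrite k0 D.
  by field; exact: k0.
have [g0] := G (pt0 d); have [g1] := G (pt1 d); have [goo] := G (ptoo d).
rewrite zpt0 zpt1 zptoo /= !(mulr0, mulr1, addr0, add0r).
set G11 := b' * - c + a' * e; set G12 := b' * a - a' * b.
set G21 := e' * - c + c' * e; set G22 := e' * a - c' * b.
move=> [_ h21] [h1 h1'] [h12 _].
have eG : G22 = G11 by move: h1 h1'; rewrite h21 h12 addr0 add0r => -> ->.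
pose D0 := a * e - b * c.
have eqs : [/\ a' = G11 / D0 * a, b' = G11 / D0 * b, c' = G11 / D0 * c & e' = G11 / D0 * e].
  have sc z z' : z' * D0 = G11 * z -> z' = G11 / D0 * z.
    by move=> zE; apply: (mulIf D); rewrite -/D0 zE mulrAC divfK.
  split; apply: sc.
  - by rewrite -[RHS]addr0 -(mul0r c) -h12 /G11 /G12 /D0; ring.
  - by rewrite -[RHS]addr0 -(mul0r e) -h12 /G11 /G12 /D0; ring.
  - by rewrite -[RHS]addr0 -(mul0r a) -h21 -eG /G22 /G21 /D0; ring.
  - by rewrite -[RHS]addr0 -(mul0r b) -h21 -eG /G22 /G21 /D0; ring.
exists (G11 / D0) => //; apply: contraNneq D' => z0.
by case: eqs; rewrite z0 !mul0r => -> -> _ _; rewrite !mul0r subrr.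
Qed.

Let mx3 (rows : seq (seq K)) : 'M[K]_3 := \matrix_(i, j) nth 0 (nth [::] rows i) j.

(** The derivative is the map induced by the monomial matrix [P] on the quotient by
    the quadratic forms, whose values at the points are the columns of [V]. *)
Lemma trace_jacobian_aux lam s : Kn lam -> gmap s lam = lam ->
  exists a b c e k, carries lam s a b c e k /\
    \tr (Xrep lam (gmap s)) = \sum_(i | s i == i) (a * e - b * c) / k i ^+ 2 -
        ((a + e) ^+ 2 / (a * e - b * c) - 1).
Proof.
move=> kl gl; have [a [b [c [e [k [hk hq]]]]]] := jacobian_structure kl gl.
exists a, b, c, e, k; split=> //.
have [D0 hc] := hk; set D := a * e - b * c in D0 hq *.
have /fin_all_exists [q0 /fin_all_exists [q1 /fin_all_exists[q2 hqd]]] :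
  forall m : 'I_d, exists q0 q1 q2 : K, forall i,
      extend0 ('d (gmap s) lam (delta_mx 0 m)) (s i) = D / k i ^+ 2 * extend0 (delta_mx 0 m) i -
        (q0 * xcoord lam (s i) ^+ 2 + q1 * (xcoord lam (s i) * ycoord lam (s i)) +
          q2 * ycoord lam (s i) ^+ 2).
  by move=> m; apply: hq.
pose P : 'M[K]_(3 + d) := \matrix_(j, i) (if j == s i then D / k i ^+ 2 else 0).
pose V : 'M[K]_(3 + d, 3) := \matrix_(i, m)
  nth 0 [:: xcoord lam i ^+ 2; xcoord lam i * ycoord lam i; ycoord lam i ^+ 2] m.
(* The action on the forms X^2, XY, Y^2: composition with the adjugate matrix,
   divided by the determinant D. *)
pose S := mx3 [:: [:: e ^+ 2 / D; - (e * c) / D; c ^+ 2 / D];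
                  [:: - (2 * b * e) / D; (a * e + b * c) / D; - (2 * a * c) / D];
                  [:: b ^+ 2 / D; - (a * b) / D; a ^+ 2 / D]].
pose Q : 'M[K]_(3, d) := \matrix_(m, j) nth 0 [:: q0 j; q1 j; q2 j] m.
have PE p (A : 'M[K]_(3 + d, p)) i j : (P *m A) (s i) j = D / k i ^+ 2 * A i j.
  rewrite mxE (bigD1 i) //= big1 ?addr0 ?mxE ?eqxx // => l li.
  by rewrite mxE (inj_eq perm_inj) eq_sym (negPf li) mul0r.
have trP : \tr P = \sum_(i | s i == i) D / k i ^+ 2.
  by rewrite /mxtrace [RHS]big_mkcond; apply: eq_bigr => i _; rewrite mxE eq_sym.
have trS : \tr S = (a + e) ^+ 2 / D - 1.
  rewrite /mxtrace !big_ord_recl big_ord0 !mxE /= /D; field.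
  exact: D0.
rewrite -trP -trS; apply: (@trace_quotient _ 3 d P V S _ Q).
(* The values of X^2, XY, Y^2 at 0 = (0, 1), 1 = (1, 1), oo = (1, 0) form an
   invertible matrix, with inverse W. *)
- pose W := mx3 [:: [:: 0; 0; 1]; [:: -1; 1; -1]; [:: 1; 0; 0]].
  suff /mulmx1_unit[] : W *m usubmx V = 1%:M by [].
  have VE i m : usubmx V i m =
      nth 0 (nth [::] [:: [:: 0; 0; 1]; [:: 1; 1; 1]; [:: 1; 0; 0]] i) m :> K.
    rewrite !mxE; case: i => -[|[|[|//]]] hi.
    + have -> : lshift d (Ordinal hi) = pt0 d by apply: val_inj.
      rewrite /xcoord /ycoord zpt0 /= expr0n mul0r expr1n.
      by case: m => -[|[|[|//]]].
    + have -> : lshift d (Ordinal hi) = pt1 d by apply: val_inj.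
      rewrite /xcoord /ycoord zpt1 /= mul1r expr1n.
      by case: m => -[|[|[|//]]].
    + have -> : lshift d (Ordinal hi) = ptoo d by apply: val_inj.
      rewrite /xcoord /ycoord zptoo /= expr0n mul1r expr1n.
      by case: m => -[|[|[|//]]].
  apply/matrixP => i m; rewrite mxE !big_ord_recl big_ord0 !VE !mxE /=.
  by case: i m => -[|[|[|//]]] ? [[|[|[|//]]] ?] /=; rewrite ?eqxx /=; ring.
- apply/matrixP => j m; rewrite -(permKV s j); move: ((s^-1)%g j) => i.
  rewrite PE !mxE !big_ord_recl big_ord0 !mxE /=.
  have [k0 h1 h2] := hc i; have [xE yE] := adj_vec D0 h1 h2.
  have {}xE : xcoord lam i = k i * (e * xcoord lam (s i) - b * ycoord lam (s i)) / D by exact: xE.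
  have {}yE : ycoord lam i = k i * (a * ycoord lam (s i) - c * xcoord lam (s i)) / D by exact: yE.
  rewrite xE yE; case: m => -[|[|[|//]]] hm /=.
  + by field; rewrite k0 D0.
  + by field; rewrite k0 D0.
  + by field; rewrite k0 D0.
apply/matrixP => j m; rewrite -(permKV s j); move: ((s^-1)%g j) => i.
rewrite [RHS]mxE PE [X in _ = _ + X]mxE [X in _ = _ - X]mxE.
have cE (M : 'M[K]_d) l : col_mx (0 : 'M[K]_(3, d)) M l m = extend0 (row m M^T) l.
  by elim/config_ind: l => [|||l]; rewrite ?extend0_l ?extend0_r ?col_mxEu ?col_mxEd !mxE.
rewrite !cE trmx1 row1 /Xrep trmxK rowE.
have -> : delta_mx 0 m *m jacobian (gmap s) lam = 'd (gmap s) lam (delta_mx 0 m).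
  by rewrite /jacobian mul_rV_lin1.
rewrite hqd; congr (_ - _).
by rewrite !big_ord_recl big_ord0 !mxE /= addr0 addrA; ring.
Qed.

(** The right-hand side is unchanged when the matrix is scaled, and a matrix that
    carries the configuration is unique up to scaling; so any one may be used. *)
Lemma trace_jacobian lam s a b c e k : Kn lam -> gmap s lam = lam ->
  carries lam s a b c e k ->
  \tr (Xrep lam (gmap s)) = \sum_(i | s i == i) (a * e - b * c) / k i ^+ 2 -
        ((a + e) ^+ 2 / (a * e - b * c) - 1).
Proof.
move=> kl gl hk; have [a' [b' [c' [e' [k' [hk' ->]]]]]] := trace_jacobian_aux kl gl.
have [z z0 [aE bE cE eE]] := carries_unique hk hk'.
have [D hc] := hk; have [_ hc'] := hk'.
have kE i : k' i = z * k i.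
  have [k0 h1 h2] := hc i; have [k0' h1' h2'] := hc' i.
  have := hom_neq0 (zpt lam (s i)); case/orP => nz; apply: (mulIf nz); rewrite -mulrA.
    by rewrite -h1 -h1' aE bE; ring.
  by rewrite -h2 -h2' cE eE; ring.
rewrite aE bE cE eE; congr (_ - (_ - _)); last first.
  field; rewrite D.
  have -> : z * a * (z * e) - z * b * (z * c) = z ^+ 2 * (a * e - b * c) by ring.
  by rewrite mulf_neq0 // expf_neq0.
apply: eq_bigr => i _; rewrite kE; have [k0 _ _] := hc i.
by field; rewrite k0 z0.
Qed.
End TraceJacobian.

(** * Roots of unity and the sets A_p, B_p, C_p *)

Section RootsOfUnity.
Variable R : realType.
Implicit Types s t : R.

Lemma cisD s t : cis (s + t) = cis s * cis t.
Proof. by rewrite /cis sinD cosD; congr (_ +i* _)%C; ring. Qed.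

Lemma cis0 : cis (0 : R) = 1.
Proof. by rewrite /cis cos0 sin0. Qed.

Lemma cisX t n : cis t ^+ n = cis (n%:R * t).
Proof.
elim: n => [|n IH]; first by rewrite mul0r cis0.
by rewrite exprS IH -cisD; congr cis; rewrite -[n.+1]add1n natrD mulrDl mul1r.
Qed.

Lemma cis_neq0 t : cis t != 0.
Proof.
by apply/eqP => h; have := cisD t (- t); rewrite subrr cis0 h mul0r => /eqP; rewrite oner_eq0.
Qed.

Lemma cisV t : (cis t)^-1 = cis (- t).
Proof.
by apply: (mulfI (cis_neq0 t)); rewrite divff ?cis_neq0 // -cisD subrr cis0.
Qed.

Lemma cis_pi : cis (pi : R) = -1.
Proof. by rewrite /cis cospi sinpi -[RHS]/((-1) +i* (-0))%C oppr0. Qed.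

Lemma cis_2pi : cis (2 * pi : R) = 1.
Proof.
have -> : 2 * pi = pi + pi :> R by ring.
by rewrite cisD cis_pi mulrNN mulr1.
Qed.

Lemma cis_int_2pi (k : int) : cis (k%:~R * (2 * pi) : R) = 1.
Proof.
by case: k => n; rewrite ?NegzE ?mulrNz ?mulNr -?cisV -cisX cis_2pi expr1n ?invr1.
Qed.

(** The cosine of [t] is [1 - 2 sin(t/2)^2], and [t/2] lies in the open interval from 0
    to pi. *)
Lemma cis_eq1 t : 0 < t < 2 * pi -> cis t != 1.
Proof.
move=> /andP[t0 t2]; have s0 : 0 < sin (t / 2) by apply: sin_gt0_pi; lra.
apply/eqP => -[ct _].
have tE : t = (t / 2) *+ 2 by rewrite -mulr_natr divfK ?pnatr_eq0.
move: ct; rewrite tE cos_mulr2n cos2sin2 => h.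
have : sin (t / 2) ^+ 2 = 0 by lra.
by move/eqP; rewrite expf_eq0 /= gt_eqF.
Qed.

Lemma cis_prim q : (0 < q)%N -> q.-primitive_root (cis (1 / q%:R * (2 * pi)) : R[i]).
Proof.
move=> q0; have qR : 0 < q%:R :> R by rewrite ltr0n.
apply/andP; split=> //; apply/forallP => i; rewrite unity_rootE cisX.
have -> : i.+1%:R * (1 / q%:R * (2 * pi)) = i.+1%:R / q%:R * (2 * pi) :> R.
  by rewrite div1r mulrA.
have [->|iq] := eqVneq i.+1 q.
  by rewrite divff ?mul1r ?cis_2pi ?eqxx // (gt_eqF qR).
have pi0 := pi_gt0 R.
rewrite (negPf (cis_eq1 _)) //; apply/andP; split.
  by rewrite !mulr_gt0 // invr_gt0.
rewrite gtr_pMl ?mulr_gt0 // ltr_pdivrMr // mul1r ltr_nat ltn_neqAle iq.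
exact: ltn_ord.
Qed.

Lemma root_cisP q (x : R[i]) : (0 < q)%N ->
  x ^+ q = 1 <-> exists k : int, x = cis (k%:~R / q%:R * (2 * pi)).
Proof.
move=> q0; have qR : q%:R != 0 :> R by rewrite pnatr_eq0 -lt0n.
split=> [xq|[k ->]].
  have [i ->] := prim_rootP (cis_prim q0) xq; exists (Posz i); rewrite cisX.
  by congr cis; rewrite div1r mulrA.
rewrite cisX.
have -> : q%:R * (k%:~R / q%:R * (2 * pi)) = k%:~R * (2 * pi) :> R by field.
exact: cis_int_2pi.
Qed.

Variable p : nat.
Hypotheses (p_odd : odd p).
Let p0 : (0 < p)%N. Proof. by lia. Qed.
Let pR : p%:R != 0 :> R. Proof. by rewrite pnatr_eq0 -lt0n. Qed.

Lemma AsetE : Aset p = [set z : sphere R | exists2 x, z = Some x & x ^+ p = 1].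
Proof.
apply/seteqP; split=> z.
  by move=> [k _ <-]; eexists; [reflexivity | apply/root_cisP => //; exists k].
by move=> [x -> /(root_cisP _ p0) [k ->]]; exists k.
Qed.

(** Multiplication by -1 exchanges the roots of 1 and of -1, because [p] is odd. *)
Lemma BsetE : Bset p = [set z : sphere R | exists2 x, z = Some x & x ^+ p = -1].
Proof.
apply/seteqP; split=> z.
  move=> [k _ <-]; eexists; first reflexivity.
  rewrite cisX.
  have -> : p%:R * ((2 * k%:~R + 1) / (2 * p%:R) * (2 * pi)) = k%:~R * (2 * pi) + pi :> R.
    by field.
  by rewrite cisD cis_int_2pi cis_pi mul1r.
move=> [x -> xp]; have : (- x) ^+ p = 1.
  by rewrite exprNn xp -signr_odd p_odd expr1 mulrNN mulr1.
(* - x has argument 2 pi k / p and -1 = cis pi; adding pi amounts to adding p/2 to k,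
   and p/2 = p./2 + 1/2. *)
move=> /(root_cisP _ p0) [k xk]; exists (k + Posz p./2) => //; congr Some.
have -> : x = cis (pi : R) * - x by rewrite cis_pi mulN1r opprK.
rewrite xk -cisD; congr cis.
have pE : p%:R = 1 + 2 * (p./2)%:R :> R.
  by rewrite -{1}(odd_double_half p) p_odd natrD -muln2 natrM [_ * 2]mulrC.
rewrite intrD /= -[(Posz _)%:~R]/(p./2%:R).
have -> : (p./2)%:R = (p%:R - 1) / 2 :> R by rewrite pE; field.
by field.
Qed.

(** Within the two cosets, the condition on [p]-th powers determines the point up to
    a [p]-th root of unity. *)
Lemma CsetE (a : R[i]) : a != 0 ->
  Cset p a = [set z | exists2 x, z = Some x & x ^+ p = a ^+ p \/ x ^+ p = a ^- p].
Proof.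
move=> a0.
have aux (b : R[i]) : b != 0 -> [set Some (b * cis (k%:~R / p%:R * (2 * pi))) | k in [set: int]]
    = [set z | exists2 x, z = Some x & x ^+ p = b ^+ p].
  move=> b0; apply/seteqP; split=> z.
    move=> [k _ <-]; eexists; first reflexivity.
    rewrite exprMn; have /(root_cisP _ p0) -> : exists k' :
      int, cis (k%:~R / p%:R * (2 * pi)) = cis (k'%:~R / p%:R * (2 * pi) : R).
      by exists k.
    by rewrite mulr1.
  move=> [x -> xb]; have : (x / b) ^+ p = 1 by rewrite expr_div_n xb divff ?expf_neq0.
  move=> /(root_cisP _ p0) [k xk]; exists k => //; congr Some.
  by rewrite -xk mulrC divfK.
rewrite /Cset !aux ?invr_eq0 //; apply/seteqP; split=> z.
  by move=> [] [x -> xp]; exists x => //; [left | right; rewrite xp exprVn].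
by move=> [x -> [xp|xp]]; [left|right]; exists x; rewrite ?exprVn.
Qed.

(** The excluded values of [a] are the [2 p]-th roots of unity, that is the solutions
    of [a ^+ p = 1] and [a ^+ p = -1]. *)
Lemma CgenericE (a : R[i]) : Cgeneric p a -> [/\ a != 0, a ^+ p != 1 & a ^+ p != -1].
Proof.
move=> [a0 ha]; split=> //; apply/eqP => ap.
  have /root_cisP : a ^+ (2 * p) = 1 by rewrite mulnC exprM ap expr1n.
  rewrite muln_gt0 p0 natrM => /(_ isT) [l al].
  by have := ha l; rewrite -al eqxx.
have /root_cisP : a ^+ (2 * p) = 1 by rewrite mulnC exprM ap sqrrN expr1n.
rewrite muln_gt0 p0 natrM => /(_ isT) [l al].
by have := ha l; rewrite -al eqxx.
Qed.
End RootsOfUnity.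

(** * Configurations cut out by p-th powers *)

Section RootConfigurations.
Variables (R : realType) (p : nat).
Hypotheses (p_odd : odd p).
Let p0 : (0 < p)%N. Proof. by lia. Qed.
Implicit Types (L : seq R[i]) (delta : bool) (z : sphere R).

(** The common shape of the six models: each orbit of the rotations other than the
    two poles is the set of [p]-th roots of some nonzero [c], and [L] lists the values
    [c]. *)
Definition root_config delta L : set (sphere R) :=
  [set z | if z is Some x then (if x == 0 then delta else x ^+ p \in L) else delta].

(** Invariance of [L] under inversion makes the configuration invariant under the
    reflections. *)
Definition symmetric_roots L := [/\ uniq L, 0 \notin L & forall c, c \in L -> c^-1 \in L].

Definition root_config_points delta L : seq (sphere R) :=
  (if delta then [:: Some 0; None] else [::]) ++
  [seq Some (p.-root c * cis (1 / p%:R * (2 * pi)) ^+ k) | c <- L, k <- iota 0 p].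

Lemma size_root_config_points delta L : size (root_config_points delta L) =
  (2 * delta + p * size L)%N.
Proof.
by rewrite size_cat size_allpairs size_iota mulnC; case: delta.
Qed.

Let zeta : R[i] := cis (1 / p%:R * (2 * pi)).
Let zprim : p.-primitive_root zeta. Proof. exact: cis_prim. Qed.
Let zX k : (zeta ^+ k) ^+ p = 1. Proof. by rewrite exprAC (prim_expr_order zprim) expr1n. Qed.

Lemma mem_root_config_points delta L z : symmetric_roots L ->
  (z \in root_config_points delta L) = `[< root_config delta L z >].
Proof.
move=> [_ L0 _]; apply/idP/asboolP; rewrite mem_cat.
  case/orP=> [|/allpairsP [[c k] /= [cL _ ->]]].
    by case: delta => //; rewrite !inE => /orP[] /eqP ->; rewrite /= ?eqxx.
  have c0 : c != 0 by apply: contraNneq L0 => <-.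
  rewrite /= mulf_eq0 rootC_eq0 // (negPf c0) (negPf (expf_neq0 _ (cis_neq0 _))) /=.
  by rewrite exprMn rootCK // -/zeta zX mulr1.
case: z => [x|] /=; last by case: delta; rewrite // !inE eqxx orbT.
case: eqVneq => [->|x0]; first by case: delta; rewrite // !inE eqxx.
move=> xL; apply/orP; right.
have : (x / p.-root (x ^+ p)) ^+ p = 1 by rewrite expr_div_n rootCK // divff // expf_neq0.
move=> /(prim_rootP zprim) [k xk]; apply/allpairsP; exists (x ^+ p, val k); split=> //=.
  by rewrite mem_iota /= add0n.
by rewrite -/zeta -xk mulrC divfK // rootC_eq0 // expf_neq0.
Qed.

Lemma uniq_root_config_points delta L : symmetric_roots L -> uniq (root_config_points delta L).
Proof.
move=> [uL L0 _]; rewrite cat_uniq.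
have nz c k : c \in L -> p.-root c * zeta ^+ k != 0.
  move=> cL; have c0 : c != 0 by apply: contraNneq L0 => <-.
  by rewrite mulf_neq0 ?rootC_eq0 // expf_neq0 // cis_neq0.
apply/and3P; split; first by case: delta.
  apply/hasPn => z /allpairsP [[c k] /= [cL _ ->]].
  by case: delta; rewrite // !inE orbF; apply: contra (nz c k cL) => /eqP[->].
apply: allpairs_uniq => //; first exact: iota_uniq.
move=> [c k] [c' k'] /allpairsP [[a i] /= [aL ip [->
  ->]]] /allpairsP [[a' i'] /= [aL' ip' [-> ->]]] [] h.
have aa : a = a'.
  have := congr1 (fun x => x ^+ p) h; rewrite /= !exprMn !rootCK //.
  by rewrite -/zeta !zX !mulr1.
have a0 : p.-root a != 0 by rewrite rootC_eq0 //; apply: contraNneq L0 => <-.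
move: h; rewrite -aa => /(mulfI a0) /eqP; rewrite (eq_prim_root_expr zprim).
move: ip ip'; rewrite !mem_iota /= !add0n => ip ip'.
by rewrite !modn_small // => /eqP ->.
Qed.

(** Each element of [L] contributes its [p] roots, and the poles two points. *)
Lemma card_root_config d (lam : 'rV[R[i]]_d) h delta L : Kn lam -> is_lft h ->
  h @` config lam = root_config delta L -> symmetric_roots L ->
  (3 + d = 2 * delta + p * size L)%N.
Proof.
move=> kl lh hm sL; rewrite -size_root_config_points.
have inj : injective (fun i => h (zpt lam i)).
  by move=> i j /(lft_inj lh) /((Kn_zpt lam).1 kl).
have /perm_size : perm_eq [seq h (zpt lam i) | i : 'I_(3 + d)] (root_config_points delta L).
  apply: uniq_perm; [by rewrite map_inj_uniq // enum_uniq | exact: uniq_root_config_points|].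
  move=> z; rewrite mem_root_config_points //; apply/idP/asboolP.
    move=> /mapP [i _ ->]; rewrite -hm.
    by exists (zpt lam i) => //; exists i.
  by rewrite -hm => -[_ [i _ <-] <-]; apply/mapP; exists i; rewrite // mem_enum.
by rewrite size_map size_enum_ord.
Qed.

(** The [p]-th powers of the points of the orbits [C_p(a_i)]. *)
Definition orbit_roots m (a : 'I_m -> R[i]) : seq R[i] :=
  [seq (if x.2 then a x.1 ^+ p else a x.1 ^- p) | x : 'I_m * bool].

(** Adding the orbits [C_p(a_i)] to a model [S0] adds to [l0] the values [a_i ^+ p]
    and [a_i ^- p].  These [2 m] values are pairwise distinct, because the orbits are
    distinct and [a_i ^+ p] is not 1 or -1, and for this last reason they do not
    meet [l0]. *)
Lemma of_form_root_config d m (S0 : set (sphere R)) l0 delta (lam : 'rV[R[i]]_d) :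
  S0 = root_config delta l0 -> symmetric_roots l0 -> {subset l0 <= [:: 1; -1]} ->
  of_form p m S0 lam -> exists h L, [/\ is_lft h, h @` config lam = root_config delta L,
    symmetric_roots L, size L = (size l0 + 2 * m)%N & (1 \in L) = (1 \in l0) /\
      (-1 \in L) = (-1 \in l0)].
Proof.
move=> S0E [ul0 l00 l0V] l0s [a [ag ai [h lh hE]]].
have ag' i := CgenericE p_odd (ag i).
pose L := l0 ++ orbit_roots a.
have aV i : a i ^- p != 1 /\ a i ^- p != -1.
  have [_ a1 aN1] := ag' i; split; first by rewrite -[1]invr1 (inj_eq invr_inj).
  by rewrite -[-1]invrK invrN invr1 (inj_eq invr_inj).
have orbit_ex c : c \in orbit_roots a -> exists i, c = a i ^+ p \/ c = a i ^- p.
  by move=> /mapP [[i b] _ ->] /=; exists i; case: b; [left|right].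
have orb1 c : c \in [:: 1; -1] -> c \notin orbit_roots a.
  move=> c1; apply/negP => co; have [j] := orbit_ex _ co; have [_ a1 aN1] := ag' j;
    have [b1 bN1] := aV j.
  by move=> [] cE; move: c1; rewrite !inE cE ?(negPf a1) ?(negPf aN1) ?(negPf b1) ?(negPf bN1).
have Cs i j : a i ^+ p = a j ^+ p \/ a i ^+ p = a j ^- p -> i = j.
  have [ai0 _ _] := ag' i; have [aj0 _ _] := ag' j.
  move=> H; apply: ai; rewrite !(CsetE p_odd) //.
  by case: H => ->; rewrite ?invrK //; apply/seteqP; split=> z [x -> H]; exists x => //;
    case: H; auto.
have finj : injective (fun x : 'I_m * bool => if x.2 then a x.1 ^+ p else a x.1 ^- p).
  have nV i : a i ^+ p != a i ^- p.
    have [a0 a1 aN1] := ag' i; apply/eqP => H.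
    have : a i ^+ p * a i ^+ p = 1 by rewrite {2}H divff // expf_neq0.
    by move/eqP; rewrite -expr2 sqrf_eq1 (negPf a1) (negPf aN1).
  move=> [i [|]] [j [|]] /= H.
  - by have -> : i = j by apply: Cs; left.
  - have ij : i = j by apply: Cs; right.
    by move: H; rewrite ij => /eqP; rewrite (negPf (nV j)).
  - have ij : j = i by apply: Cs; right.
    by move: H; rewrite ij => /esym/eqP; rewrite (negPf (nV i)).
  - by have -> : i = j by apply: Cs; left; apply: invr_inj.
have sL : symmetric_roots L.
  split.
  - rewrite cat_uniq ul0 /= map_inj_uniq ?enum_uniq // andbT.
    apply/hasPn => c co; apply/negP => /l0s c1; move: co; apply/negP; exact: orb1.
  - rewrite mem_cat (negPf l00) /=; apply/negP => co; have [j] := orbit_ex _ co;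
    have [a0 _ _] := ag' j.
    by move=> [] /esym/eqP; rewrite ?invr_eq0 expf_eq0 p0 (negPf a0).
  - move=> c; rewrite !mem_cat => /orP[/l0V->//|/mapP[[i b] _ ->]]; apply/orP; right.
    apply/mapP; exists (i, ~~ b); rewrite ?mem_enum //=.
    by case: b => //=; rewrite invrK.
exists h, L; split=> //.
- rewrite hE S0E; apply/seteqP; split=> z.
    case=> [|[i _]]; last rewrite (CsetE p_odd); last by case: (ag' i).
      case: z => [x|] //=; case: eqVneq => // _ xl; by rewrite mem_cat xl.
    have [a0 _ _] := ag' i.
    move=> [x -> xp] /=; have x0 : x != 0.
      apply/eqP => xx; move: xp; rewrite xx expr0n eqn0Ngt p0 /=.
      by case=> /esym/eqP; rewrite ?invr_eq0 expf_eq0 p0 (negPf a0).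
    rewrite (negPf x0) mem_cat; apply/orP; right; apply/mapP.
    by case: xp => ->; [exists (i, true) | exists (i, false)]; rewrite ?mem_enum.
  case: z => [x|] /=; last by move=> dl; left.
  case: (eqVneq x 0) => [x0 dl|x0]; first by left.
  rewrite mem_cat => /orP[xl|/orbit_ex [i xp]]; first by left.
  by right; exists i => //; rewrite (CsetE p_odd); [exists x | case: (ag' i)].
- by rewrite size_cat size_map -cardE card_prod card_ord card_bool [(2 * m)%N]mulnC.
- by rewrite !mem_cat !(negPf (orb1 _ _)) ?inE ?eqxx ?orbT ?orbF.
Qed.

Lemma poles_root_config : (@poles R) = root_config true [::].
Proof.
apply/seteqP; split=> z; first by case=> -> /=; rewrite ?eqxx.
by case: z => [x|] /=; [case: eqVneq => [->|//]; left | right].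
Qed.

Lemma root_config_polesU delta l : (if delta then @poles R else set0) `|` root_config false l
  = root_config delta l.
Proof.
apply/seteqP; split=> z.
  case; first by case: delta => // -[] -> /=; rewrite ?eqxx.
  by case: z => [x|] //=; case: eqP.
case: z => [x|] /=; last by move=> dl; left; rewrite dl; right.
by case: eqVneq => [->|x0]; [move=> ->; left; left | right].
Qed.

Lemma Aset_root_config : Aset p = root_config false [:: 1].
Proof.
rewrite AsetE //; apply/seteqP; split=> z.
  move=> [x -> xp] /=; rewrite inE xp eqxx; case: eqP => // x0.
  by move: xp => /eqP; rewrite x0 expr0n eqn0Ngt p0 eq_sym oner_eq0.
by case: z => [x|] //=; case: eqP => // _; rewrite inE => /eqP xp; exists x.
Qed.

Lemma Bset_root_config : Bset p = root_config false [:: -1].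
Proof.
rewrite BsetE //; apply/seteqP; split=> z.
  move=> [x -> xp] /=; rewrite inE xp eqxx; case: eqP => // x0.
  by move: xp => /eqP; rewrite x0 expr0n eqn0Ngt p0 eq_sym oppr_eq0 oner_eq0.
by case: z => [x|] //=; case: eqP => // _; rewrite inE => /eqP xp; exists x.
Qed.

Lemma root_configU l l' : root_config false l `|` root_config false l' =
  root_config false (l ++ l').
Proof.
apply/seteqP; split=> -[x|] //=; try (by case); case: eqP => //= _.
- by case.
- by move=> [] xl; rewrite mem_cat xl ?orbT.
- by rewrite mem_cat => /orP.
Qed.
End RootConfigurations.

(** * The stabilizer of a dihedral configuration *)

(** The chain rule; the product is in this order because the Jacobian acts on row
    vectors. *)
Lemma jacobian_comp (K : numFieldType) m n k (f : 'rV[K]_n -> 'rV[K]_k)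
    (g : 'rV[K]_m -> 'rV[K]_n) (x : 'rV[K]_m) (y : 'rV[K]_n) :
  g x = y -> differentiable g x -> differentiable f y ->
  jacobian (f \o g) x = jacobian g x *m jacobian f y.
Proof.
move=> <- dg df.
apply/row_matrixP => j; rewrite !rowE mulmxA !mul_rV_lin1.
exact: (congr1 (@^~ (delta_mx 0 j)) (diff_comp dg df)).
Qed.

Section DihedralLFT.
Variables (R : realType) (p : nat).
Hypothesis p_odd : odd p.
Let p0 : (0 < p)%N. Proof. exact: odd_gt0. Qed.
Implicit Types (x y : R[i] * bool).
Let G := @dihedral_elt (R[i] : numFieldType) p.

Definition dihedral_lft x : sphere R -> sphere R :=
  if x.2 then lft 0 x.1 1 0 else lft x.1 0 0 1.

Lemma dihedral_elt_neq0 x : x \in G -> x.1 != 0.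
Proof. by rewrite unfold_in => /eqP; apply: contra_eq_neq => ->;
  rewrite expr0n eqn0Ngt p0 eq_sym oner_eq0. Qed.

Lemma dihedral_lftE x z : dihedral_lft x z =
  of_hom ((if x.2 then 0 else x.1) * hom_x z + (if x.2 then x.1 else 0) * hom_y z)
   ((if x.2 then 1 else 0) * hom_x z + (if x.2 then 0 else 1) * hom_y z).
Proof. by rewrite /dihedral_lft; case: (x.2); rewrite lftE. Qed.

Lemma dihedral_lft_det x : (if x.2 then 0 else x.1) * (if x.2 then 0 else 1) -
  (if x.2 then x.1 else 0) * (if x.2 then 1 else 0) = if x.2 then - x.1 else x.1.
Proof. by case: (x.2); ring. Qed.

Lemma is_lft_dihedral_lft x : x.1 != 0 -> is_lft (dihedral_lft x).
Proof.
move=> x0; exists (if x.2 then 0 else x.1), (if x.2 then x.1 else 0), (if x.2 then 1 else 0),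
  (if x.2 then 0 else 1).
split; first by rewrite dihedral_lft_det; case: (x.2); rewrite ?oppr_eq0.
by rewrite /dihedral_lft; case: (x.2).
Qed.

Lemma dihedral_lftM x y : x.1 != 0 -> y.1 != 0 ->
  dihedral_lft (dihedral_mul x y) = dihedral_lft x \o dihedral_lft y.
Proof.
case: x y => [u b] [v c] /= u0 v0; apply/funext => z; rewrite /dihedral_lft /dihedral_mul /=.
have d1 (w : R[i]) : w != 0 -> 0 * 0 - w * 1 != 0 by move=> w0; rewrite mulr1 mul0r sub0r oppr_eq0.
have d2 (w : R[i]) : w != 0 -> w * 1 - 0 * 0 != 0 by move=> w0; rewrite mulr1 mul0r subr0.
case: b c => [] [] /=; rewrite lft_comp ?d1 ?d2 // !lftE ?of_homK.
- by rewrite -[RHS](of_hom_scale _ _ (k := v^-1)) ?invr_eq0 //; congr of_hom; field.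
- by rewrite -[RHS](of_hom_scale _ _ (k := v^-1)) ?invr_eq0 //; congr of_hom; field.
- by congr of_hom; ring.
- by congr of_hom; ring.
Qed.

Lemma dihedral_lft_Some0 x : x.1 != 0 -> dihedral_lft x (Some 0) = if x.2 then None else Some 0.
Proof. by move=> x0; rewrite /dihedral_lft; case: (x.2) => /=;
  rewrite !(mulr0, mul0r, addr0, add0r) ?eqxx ?oner_eq0 ?mul0r. Qed.
Lemma dihedral_lft_None x : x.1 != 0 -> dihedral_lft x None = if x.2 then Some 0 else None.
Proof. by move=> x0; rewrite /dihedral_lft; case: (x.2) => /=; rewrite ?eqxx ?oner_eq0 ?mul0r. Qed.
Lemma dihedral_lft_Some x a : a != 0 -> dihedral_lft x (Some a) =
  Some (if x.2 then x.1 / a else x.1 * a).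
Proof.
move=> a0; rewrite /dihedral_lft; case: (x.2) => /=; rewrite !(mulr0, mul0r, addr0, add0r, mul1r).
  by rewrite (negPf a0).
by rewrite oner_eq0 divr1.
Qed.

Lemma dihedral_lft_inj x y : x.1 != 0 -> y.1 != 0 -> dihedral_lft x = dihedral_lft y -> x = y.
Proof.
move=> x0 y0 H; have b : x.2 = y.2.
  by have := congr1 (@^~ (Some 0)) H; rewrite /= !dihedral_lft_Some0 //; case: (x.2); case: (y.2).
have := congr1 (@^~ (Some 1)) H; rewrite /= !dihedral_lft_Some ?oner_eq0 // b !divr1 !mulr1.
rewrite !if_same => -[xy]; by case: x y b xy {x0 y0 H} => [? ?] [? ?] /= -> ->.
Qed.

Lemma dihedral_lft_root_config delta L x z : symmetric_roots L -> x \in G ->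
  root_config p delta L z -> root_config p delta L (dihedral_lft x z).
Proof.
move=> [_ _ LV] xG; have x0 := dihedral_elt_neq0 xG.
have xp : x.1 ^+ p = 1 by apply/eqP; move: xG; rewrite unfold_in.
case: z => [a|] /=; last first.
  by rewrite dihedral_lft_None //; case: (x.2) => //=; rewrite eqxx.
case: eqVneq => [->|a0 aL].
  by rewrite dihedral_lft_Some0 //; case: (x.2) => //=; rewrite eqxx.
rewrite dihedral_lft_Some //=; case: (x.2).
  by rewrite mulf_eq0 invr_eq0 (negPf x0) (negPf a0) /= expr_div_n xp div1r LV.
by rewrite mulf_eq0 (negPf x0) (negPf a0) /= exprMn xp mul1r.
Qed.

(** The LFT [k] conjugating a rotation to another one maps fixed points to fixed
    points: if it preserves 0 and infinity the multipliers agree, and if it exchanges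
    them they are inverse.  A reflection is an involution, so it is not conjugate to
    a rotation whose square is not the identity. *)
Lemma dihedral_lft_conj_rotation x t (k : sphere R -> sphere R) : x \in G -> is_lft k ->
  k \o dihedral_lft x = rotation t \o k -> cis t ^+ 2 != 1 ->
  x.2 = false /\ (x.1 = cis t \/ x.1 = (cis t)^-1).
Proof.
move=> xG lk kE t2; have x0 := dihedral_elt_neq0 xG; have ct0 := cis_neq0 t.
have {}kE w : k (dihedral_lft x w) = rotation t (k w) := congr1 (@^~ w) kE.
case: x xG x0 kE => u [] xG /= u0 kE.
  have [k' [_ kk' k'k]] := is_lft_inv lk.
  have rr w : dihedral_lft (u, true) (dihedral_lft (u, true) w) = w.
    have := congr1 (@^~ w) (dihedral_lftM (x := (u, true)) (y := (u, true)) u0 u0).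
    rewrite /dihedral_mul /= mulfV // => <-.
    by rewrite dihedral_lftE /= !(mul1r, mul0r, addr0, add0r) of_homK.
  have := kE (dihedral_lft (u, true) (k' (Some 1))); rewrite rr kE k'k => /Some_inj.
  by rewrite mulr1 => h; move: t2; rewrite expr2 -h eqxx.
split=> //; have t1 : cis t != 1 by apply: contraNneq t2 => ->; rewrite expr1n.
have fixr w : rotation t w = w -> w = Some 0 \/ w = None.
  case: w => [y|]; [move=> /Some_inj h; left | by right].
  congr Some; apply/eqP; have /eqP := h.
  by rewrite -subr_eq0 -{2}(mul1r y) -mulrBl mulf_eq0 subr_eq0 (negPf t1).
have f0 : rotation t (k (Some 0)) = k (Some 0) by rewrite -kE dihedral_lft_Some0.
have foo : rotation t (k None) = k None by rewrite -kE dihedral_lft_None.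
have ki := lft_inj lk; have [a [b [c [e [D kD]]]]] := lk.
have k1 := kE (Some 1); rewrite dihedral_lft_Some ?oner_eq0 //= mulr1 in k1.
(* Of the four cases, those in which k 0 = k oo contradict the injectivity of k. *)
case: (fixr _ f0) => k0; case: (fixr _ foo) => koo;
  try by have := ki (Some 0) None; rewrite k0 koo => /(_ erefl).
- left; move: k0 koo; rewrite kD.
  move=> /(lft_eq (Some 0) (Some 0) D) b0 /(lft_eq None None D) c0.
  move: b0 c0; rewrite /= !(mulr0, mulr1, add0r, addr0) => b0 c0.
  move: k1 D; rewrite kD /= b0 -c0 !(mul0r, add0r, addr0, mulr1, subr0) mulf_eq0 negb_or.
  move=> + /andP[a0 e0]; rewrite (negPf e0) /= => /Some_inj h.
  apply: (mulfI a0); apply: (mulIf (x := e^-1)); rewrite ?invr_eq0 // h.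
  by rewrite mulrCA -mulrA.
- right; move: k0 koo; rewrite kD.
  move=> /(lft_eq (Some 0) None D) e0 /(lft_eq None (Some 0) D) a0.
  move: e0 a0; rewrite /= !(mulr0, mulr1, add0r, addr0) => e0 a0.
  move: k1 D; rewrite kD /= -e0 a0 !(mul0r, add0r, addr0, mulr1, sub0r) oppr_eq0 !mulf_eq0 negb_or.
  move=> + /andP[b0 c0]; rewrite (negPf c0) (negPf u0) /= => /Some_inj h.
  have : u^-1 = cis t.
    apply: (mulfI (x := b / c)); first by rewrite mulf_neq0 // invr_eq0.
    by rewrite [RHS]mulrC -h invfM mulrA.
  by move=> <-; rewrite invrK.
Qed.
End DihedralLFT.

Section Action.
Variables (R : realType) (d p : nat) (lam : 'rV[R[i]]_d).
Hypotheses (p_odd : odd p) (p_ge3 : (3 <= p)%N) (d_ge2 : (2 <= d)%N) (kl : Kn lam).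
Variables (h : sphere R -> sphere R) (delta : bool) (L : seq R[i]).
Hypotheses (lh : is_lft h) (hm : h @` config lam = root_config p delta L) (sL : symmetric_roots L).
Hypothesis dih : stab_dihedral p lam.
Let G := @dihedral_elt (R[i] : numFieldType) p.
Let p0 : (0 < p)%N. Proof. by lia. Qed.
Let zeta : R[i] := cis (1 / p%:R * (2 * pi)).
Let zprim : p.-primitive_root zeta. Proof. exact: cis_prim. Qed.
Let z i := h (zpt lam i).
Let z_inj : injective z.
Proof. by move=> i j /(lft_inj lh) /((Kn_zpt lam).1 kl). Qed.

Lemma root_configP w : root_config p delta L w <-> exists i, z i = w.
Proof.
rewrite -hm; split=> [[_ [i _ <-] <-]|[i <-]]; first by exists i.
by exists (zpt lam i) => //; exists i.
Qed.

Lemma dihedral_mul_elt x y : x \in G -> y \in G -> dihedral_mul x y \in G.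
Proof.
rewrite !unfold_in /dihedral_elt /= => /eqP xp /eqP yp; rewrite exprMn xp mul1r.
by case: (x.2); rewrite ?exprVn yp ?invr1.
Qed.

(** The dihedral group preserves the model, so it permutes its points. *)
Lemma exists_sigma : exists sigma : R[i] * bool -> 'S_(3 + d),
  forall x, x \in G -> forall i, z (sigma x i) = dihedral_lft x (z i).
Proof.
suff /choice [f hf] : forall x, exists s : 'S_(3 + d), x \in G ->
  forall i, z (s i) = dihedral_lft x (z i).
  by exists f.
move=> x.
have [xG|_] := boolP (x \in G); last by exists 1%g.
have /fin_all_exists [f hf] : forall i, exists j, z j = dihedral_lft x (z i).
  by move=> i; apply/root_configP; apply: dihedral_lft_root_config => //; apply/root_configP;
    exists i.
have fi : injective f.
  move=> i j fij; apply: z_inj.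
  by have /(_ (z i) (z j)) := lft_inj (is_lft_dihedral_lft (dihedral_elt_neq0 p_odd xG));
    apply; rewrite -!hf fij.
by exists (perm fi) => _ i; rewrite permE hf.
Qed.

(** [x |-> g x] will be the isomorphism from the concrete dihedral group onto the
    stabilizer. *)
Variable sigma : R[i] * bool -> 'S_(3 + d).
Hypothesis sigmaP : forall x, x \in G -> forall i, z (sigma x i) = dihedral_lft x (z i).
Let g x := @gmap R d (sigma x).

Lemma fmap_sigma x : x \in G -> h \o fmap (sigma x) lam = dihedral_lft x \o h /\ g x lam = lam.
Proof.
move=> xG; have [h' [lh' hh' h'h]] := is_lft_inv lh.
have lf := is_lft_comp lh' (is_lft_comp (is_lft_dihedral_lft (dihedral_elt_neq0 p_odd xG)) lh).
have [|fE gE] := gmap_unique (s := sigma x) kl kl lf; last first.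
  by split; [apply/funext => w; rewrite /= fE /= h'h | exact: gE].
by move=> i; rewrite /= -[h (zpt lam i)]/(z i) -sigmaP // hh'.
Qed.

Lemma sigma_mul x y : x \in G -> y \in G -> sigma (dihedral_mul x y) = (sigma y * sigma x)%g.
Proof.
move=> xG yG; apply/permP => i; rewrite permM; apply: z_inj.
rewrite !sigmaP ?dihedral_mul_elt // dihedral_lftM //.
  exact: (dihedral_elt_neq0 p_odd xG).
exact: (dihedral_elt_neq0 p_odd yG).
Qed.

Lemma one_elt b : (1, b) \in G.
Proof. by rewrite unfold_in /dihedral_elt /= expr1n. Qed.

Lemma sigma1 : sigma (1, false) = 1%g.
Proof.
apply/permP => i; rewrite perm1; apply: z_inj; rewrite sigmaP ?one_elt //.
by rewrite dihedral_lftE /= !(mul1r, mul0r, addr0, add0r) of_homK.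
Qed.

Lemma g_mul x y : x \in G -> y \in G -> g (dihedral_mul x y) = g x \o g y.
Proof. by move=> xG yG; rewrite /g sigma_mul // gmap_comp. Qed.

Lemma g1 : g (1, false) = id.
Proof. by rewrite /g sigma1 gmap1. Qed.

Lemma sigma_inj x y : x \in G -> y \in G -> sigma x = sigma y -> x = y.
Proof.
move=> xG yG xy; have x0 := dihedral_elt_neq0 p_odd xG; have y0 := dihedral_elt_neq0 p_odd yG.
have [h1 h2 h3] := injective_pt3 z_inj.
apply: dihedral_lft_inj => //.
by apply: (lft_eq3 (is_lft_dihedral_lft x0) (is_lft_dihedral_lft y0) h1 h2 h3);
  rewrite -!sigmaP // xy.
Qed.

Lemma g_inj x y : x \in G -> y \in G -> g x = g y -> x = y.
Proof. by move=> xG yG /(gmap_inj d_ge2 kl); apply: sigma_inj. Qed.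

Lemma g_stab x : x \in G -> stab lam (g x).
Proof. by move=> xG; split; [exists (sigma x) | have [] := fmap_sigma xG]. Qed.

(** The stabilizer has order [2 p] by hypothesis, and [g] is injective on the [2 p]
    elements of the concrete dihedral group. *)
Lemma stabP f : stab lam f <-> exists2 x, x \in G & f = g x.
Proof.
split=> [fs|[x xG ->]]; last exact: g_stab.
have [phi [phii phir _]] := dih.
pose T := ('I_p * bool)%type.
pose e (t : T) : R[i] * bool := (zeta ^+ t.1, t.2).
have eG t : e t \in G by rewrite unfold_in /dihedral_elt /= exprAC (prim_expr_order zprim) expr1n.
have ei : injective e.
  move=> [i b] [j c] [/eqP]; rewrite (eq_prim_root_expr zprim) !modn_small // => /eqP ij ->.
  by congr (_, _); apply: val_inj.
have /fin_all_exists [psi psiP] : forall t, exists y, phi y = g (e t).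
  move=> t; have : stab lam (g (e t)) by apply: g_stab.
  by rewrite -phir => -[y _ <-]; exists y.
have psii : injective psi.
  by move=> t t' tt'; apply/ei/g_inj => //; rewrite -!psiP tt'.
have cardT : #|{: 'I_p * bool}| = #|{: extremal.dihedral_gtype p.*2}|.
  by rewrite card_prod card_ord card_bool muln2 -cardsT extremal.card_dihedral //; lia.
have := fs; rewrite -phir => -[y _ <-].
have /(_ y)/codomP [t ->] : forall y, y \in codom psi.
  by apply: inj_card_onto psii _; rewrite cardT.
by exists (e t); rewrite ?psiP.
Qed.

Definition stab_rep x : 'M[R[i]]_d := Xrep lam (g x).

Lemma stab_rep1 : stab_rep (1, false) = 1%:M.
Proof.
rewrite /stab_rep g1 /Xrep /jacobian -[RHS]trmx1; congr (_^T).
apply/row_matrixP => k; rewrite !rowE mulmx1 mul_rV_lin1.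
have [_ e] := is_diff_id lam.
exact: (congr1 (@^~ (delta_mx 0 k)) e).
Qed.

Lemma stab_repM : {in G &, forall x y, stab_rep (dihedral_mul x y) = stab_rep x *m stab_rep y}.
Proof.
move=> x y xG yG; rewrite /stab_rep g_mul // /Xrep -trmx_mul; congr (_^T).
have [_ gx] := fmap_sigma xG; have [_ gy] := fmap_sigma yG.
have dx := (diff_gmap (sigma x) kl).1; have dy := (diff_gmap (sigma y) kl).1.
exact: jacobian_comp gy dy dx.
Qed.

(** The trace formula read in the model: both the multipliers [det/k^2] at fixed
    points and the ratio [tr^2/det] are invariant under conjugation by [h]. *)
Lemma trace_stab_rep_multipliers x : x \in G ->
  let r1 := if x.2 then 0 else x.1 in let r2 := if x.2 then x.1 else 0 in
  let r3 := if x.2 then 1 else 0 in let r4 := if x.2 then 0 else 1 in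
  exists m : 'I_(3 + d) -> R[i],
  (forall i, [/\ m i != 0, r1 * hom_x (z i) + r2 * hom_y (z i) = m i * hom_x (dihedral_lft x (z i))
     & r3 * hom_x (z i) + r4 * hom_y (z i) = m i * hom_y (dihedral_lft x (z i))]) /\
  \tr (stab_rep x) = \sum_(i | dihedral_lft x (z i) == z i) (r1 * r4 - r2 * r3) / m i ^+ 2 -
     ((r1 + r4) ^+ 2 / (r1 * r4 - r2 * r3) - 1).
Proof.
move=> xG r1 r2 r3 r4; have x0 := dihedral_elt_neq0 p_odd xG.
have rD : r1 * r4 - r2 * r3 != 0 by rewrite dihedral_lft_det; case: (x.2); rewrite ?oppr_eq0.
have rE : dihedral_lft x = lft r1 r2 r3 r4 by rewrite /dihedral_lft /r1 /r2 /r3 /r4; case: (x.2).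
have [a [b [c [e [D hE]]]]] := lh.
have /fin_all_exists [m mP] : forall i, exists m, [/\ m != 0,
    r1 * hom_x (z i) + r2 * hom_y (z i) = m * hom_x (dihedral_lft x (z i)) &
    r3 * hom_x (z i) + r4 * hom_y (z i) = m * hom_y (dihedral_lft x (z i))].
  by move=> i; have [m m0 [h1 h2]] := lft_vec (z i) rD; exists m; rewrite rE.
have /fin_all_exists [t tP] : forall i, exists t, [/\ t != 0,
    a * hom_x (zpt lam i) + b * hom_y (zpt lam i) = t * hom_x (z i) &
    c * hom_x (zpt lam i) + e * hom_y (zpt lam i) = t * hom_y (z i)].
  by move=> i; have [t t0 [h1 h2]] := lft_vec (zpt lam i) D; exists t; rewrite /z hE.
exists m; split=> //.
pose n1 := r1 * a + r2 * c; pose n2 := r1 * b + r2 * e.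
pose n3 := r3 * a + r4 * c; pose n4 := r3 * b + r4 * e.
pose D0 := a * e - b * c; pose rD0 := r1 * r4 - r2 * r3.
(* With H a matrix of h and r one of dihedral_lft x, the matrix adj(H) r H carries
   lam; its multipliers combine those of H at i, of r, and of adj(H) at sigma x i. *)
pose k i := t i * m i * D0 / t (sigma x i).
have detE : (e * n1 - b * n3) * (a * n4 - c * n2) - (e * n2 - b * n4) * (a * n3 - c * n1) =
    D0 ^+ 2 * rD0 by rewrite /n1 /n2 /n3 /n4 /D0 /rD0; ring.
have trE : (e * n1 - b * n3) + (a * n4 - c * n2) = D0 * (r1 + r4).
  by rewrite /n1 /n2 /n3 /n4 /D0; ring.
have hk : carries lam (sigma x) (e * n1 - b * n3) (e * n2 - b * n4)
    (a * n3 - c * n1) (a * n4 - c * n2) k.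
  split; first by rewrite detE mulf_neq0 // expf_neq0.
  move=> i; have [m0 m1 m2] := mP i; have [t0 t1 t2] := tP i.
  have [s0 s1 s2] := tP (sigma x i); rewrite -sigmaP // in m1 m2.
  have [X1' Y1'] := adj_vec D s1 s2.
  have eq1 : n1 * hom_x (zpt lam i) + n2 * hom_y (zpt lam i) = t i * m i * hom_x (z (sigma x i)).
    rewrite -mulrA -m1 /n1 /n2.
    transitivity (r1 * (a * hom_x (zpt lam i) + b * hom_y (zpt lam i)) +
      r2 * (c * hom_x (zpt lam i) + e * hom_y (zpt lam i))); first by ring.
    by rewrite t1 t2; ring.
  have eq2 : n3 * hom_x (zpt lam i) + n4 * hom_y (zpt lam i) = t i * m i * hom_y (z (sigma x i)).
    rewrite -mulrA -m2 /n3 /n4.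
    transitivity (r3 * (a * hom_x (zpt lam i) + b * hom_y (zpt lam i)) +
      r4 * (c * hom_x (zpt lam i) + e * hom_y (zpt lam i))); first by ring.
    by rewrite t1 t2; ring.
  split; first by rewrite /k !mulf_neq0 // invr_neq0.
    transitivity (e * (n1 * hom_x (zpt lam i) +
      n2 * hom_y (zpt lam i)) - b * (n3 * hom_x (zpt lam i) + n4 * hom_y (zpt lam i)));
        first by ring.
    rewrite eq1 eq2 X1' /k -/D0; field.
    by rewrite D s0.
  transitivity (a * (n3 * hom_x (zpt lam i) +
    n4 * hom_y (zpt lam i)) - c * (n1 * hom_x (zpt lam i) + n2 * hom_y (zpt lam i)));
      first by ring.
  rewrite eq1 eq2 Y1' /k -/D0; field.
  by rewrite D s0.
have [_ gx] := fmap_sigma xG; have D0n : D0 != 0 := D; have rDn : rD0 != 0 := rD.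
rewrite /stab_rep /g (trace_jacobian kl gx hk) detE trE; congr (_ - (_ - _)).
  apply: eq_big => [i|i /eqP si]; first by rewrite -sigmaP // (inj_eq z_inj).
  have [m0 _ _] := mP i; have [t0 _ _] := tP i.
  by rewrite /k si -/rD0; field; rewrite m0 t0 D0n.
by rewrite -/rD0; field; rewrite rDn D0n.
Qed.

Lemma sum_indicator w : \sum_i ((z i == w)%:R : R[i]) = `[< root_config p delta L w >]%:R.
Proof.
case: asboolP => [/root_configP [i <-]|nw].
  rewrite (bigD1 i) //= eqxx big1 ?addr0 // => j ji.
  by rewrite (inj_eq z_inj) (negPf ji).
rewrite big1 // => i _; case: eqP => // zw; case: nw.
by apply/root_configP; exists i.
Qed.

(** At [u = 1] the trace is the dimension, given by [card_root_config].  Otherwise the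
    fixed points are the two poles, with multipliers [u] and [u^-1], and sl_2
    contributes [u + 1 + u^-1]. *)
Lemma trace_stab_rep_rot u : u ^+ p = 1 -> \tr (stab_rep (u, false)) =
  (delta%:R - 1) * (u + u^-1) - 1 + (if u == 1 then p%:R * (size L)%:R else 0).
Proof.
move=> up; have uG : (u, false) \in G by rewrite unfold_in /dihedral_elt /= up.
have u0 : u != 0 by exact: (dihedral_elt_neq0 p_odd uG).
case: eqVneq => [->|u1].
  rewrite stab_rep1 mxtrace1.
  have h3 : 3 + d%:R = 2 * delta%:R + p%:R * (size L)%:R :> R[i].
    by rewrite -!natrM -!natrD (card_root_config p_odd kl lh hm sL).
  have -> : d%:R = 2 * delta%:R + p%:R * (size L)%:R - 3 :> R[i] by rewrite -h3; ring.
  rewrite invr1.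
  by ring.
have [m [mP ->]] := trace_stab_rep_multipliers uG; rewrite /= !(mulr1, mulr0, subr0).
have -> : \sum_(i | dihedral_lft (u, false) (z i) == z i) u / m i ^+ 2 =
    \sum_i ((z i == Some 0)%:R * u + (z i == None)%:R * u^-1).
  rewrite big_mkcond; apply: eq_bigr => i _; have [m0 m1 m2] := mP i.
  move: m1 m2; case: (z i) => [y|]; last first.
    rewrite dihedral_lft_None //= ?eqxx !(mulr1, mulr0, addr0, mul0r, add0r, mul1r) => <- _.
    by field.
  have [->|y0] := eqVneq y 0.
    rewrite dihedral_lft_Some0 //= ?eqxx !(mulr1, mulr0, addr0, mul0r, add0r, mul1r) => _ <-.
    by rewrite expr1n divr1.
  rewrite dihedral_lft_Some //= => _ _.
  have -> : (Some (u * y) == Some y) = false.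
    apply/eqP => -[] /eqP; rewrite -subr_eq0 -{2}(mul1r y) -mulrBl mulf_eq0 subr_eq0.
    by rewrite (negPf u1) (negPf y0).
  have -> : (Some y == Some 0) = false by apply/eqP => -[] /eqP; rewrite (negPf y0).
  by rewrite !mul0r addr0.
rewrite big_split /= -!mulr_suml !sum_indicator.
have -> : `[< root_config p delta L (Some 0) >] = delta by apply/asboolP/idP; rewrite /= eqxx.
have -> : `[< root_config p delta L None >] = delta by apply/asboolP/idP.
by field.
Qed.

(** The fixed points of the reflection [u / z] are the square roots of [u], with
    multiplier -1; the matrix has trace 0, so that sl_2 contributes -1. *)
Lemma trace_stab_rep_refl u : u ^+ p = 1 ->
  \tr (stab_rep (u, true)) = 1 - (1 \in L)%:R - (-1 \in L)%:R.
Proof.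
move=> up; have uG : (u, true) \in G by rewrite unfold_in /dihedral_elt /= up.
have u0 : u != 0 by exact: (dihedral_elt_neq0 p_odd uG).
have [m [mP ->]] := trace_stab_rep_multipliers uG; rewrite /= !(mulr1, mulr0, mul0r, sub0r, addr0).
rewrite expr0n mul0r sub0r opprK.
(* The square root of u that is a p-th root of unity; the p-th power of the other
   one is -1. *)
pose r := u ^+ p.+1./2.
have r2 : r ^+ 2 = u.
  rewrite -exprM; have -> : (p.+1./2 * 2 = p.+1)%N by lia.
  by rewrite exprS up mulr1.
have rp : r ^+ p = 1 by rewrite exprAC up expr1n.
have r0 : r != 0 by apply: contraNneq u0 => r0; rewrite -r2 r0 expr0n.
have -> : \sum_(i | dihedral_lft (u, true) (z i) == z i) - u / m i ^+ 2 =
    - \sum_i ((z i == Some r)%:R + (z i == Some (- r))%:R).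
  rewrite big_mkcond -sumrN; apply: eq_bigr => i _; have [m0 m1 m2] := mP i.
  move: m1 m2; case: (z i) => [y|]; last by rewrite dihedral_lft_None //= !addr0 oppr0.
  have [->|y0] := eqVneq y 0.
    rewrite dihedral_lft_Some0 //= => _ _.
    have -> : (Some 0 == Some r) = false by apply/eqP => -[] /esym/eqP; rewrite (negPf r0).
    have -> : (Some 0 == Some (- r)) = false.
      by apply/eqP => -[] /esym/eqP; rewrite oppr_eq0 (negPf r0).
    by rewrite addr0 oppr0.
  rewrite dihedral_lft_Some //= !(mulr1, mulr0, addr0, mul0r, add0r, mul1r) => _ my.
  have someE (a b : R[i]) : (Some a == Some b) = (a == b) by [].
  have -> : (Some (u / y) == Some y) = (y == r) || (y == - r).
    by rewrite someE -eqf_sqr r2 -[LHS](inj_eq (mulIf y0)) divfK // -expr2 eq_sym.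
  rewrite !someE -my; case: (eqVneq y r) => [yr|_] /=.
    have -> : (y == - r) = false.
      by apply: contraNF r0; rewrite yr -subr_eq0 opprK -mulr2n mulrn_eq0.
    by rewrite addr0 yr r2 mulNr divff.
  case: (eqVneq y (- r)) => [yr|_] /=; last by rewrite addr0 oppr0.
  by rewrite add0r yr sqrrN r2 mulNr divff.
rewrite big_split /= !sum_indicator.
have -> : `[< root_config p delta L (Some r) >] = (1 \in L).
  by apply/asboolP/idP; rewrite /= (negPf r0) rp.
have -> : `[< root_config p delta L (Some (- r)) >] = (-1 \in L).
  have sg : (-1) ^+ p = -1 :> R[i] by rewrite -signr_odd p_odd expr1.
  by apply/asboolP/idP; rewrite /= oppr_eq0 (negPf r0) exprNn rp mulr1 sg.
by ring.
Qed.

Lemma Kclass_rot k x : x \in G -> (1 <= k <= p.-1./2)%N -> Kclass p lam k (g x) ->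
  x.2 = false /\ (x.1 = cis (2 * k%:R * pi / p%:R) \/ x.1 = (cis (2 * k%:R * pi / p%:R))^-1).
Proof.
move=> xG /andP[k1 kp] [_]; rewrite kp => -[s [/(gmap_inj d_ge2 kl) <- [k2 lk2 k2E]]].
have [h' [lh' hh' h'h]] := is_lft_inv lh; have [hf _] := fmap_sigma xG.
apply: (@dihedral_lft_conj_rotation _ _ p_odd _ _ (k2 \o h')) => //; first exact: is_lft_comp.
  apply/funext => w /=; have := congr1 (@^~ (h' w)) hf; rewrite /= h'h => <-.
  by rewrite hh'; exact: (congr1 (@^~ (h' w)) k2E).
have -> : cis (2 * k%:R * pi / p%:R) = zeta ^+ k.
  rewrite /zeta cisX; congr cis; rewrite div1r.
  by rewrite mulrCA -[_ / p%:R]mulrC [2 * _ * _]mulrAC [_ * k%:R]mulrC.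
rewrite -exprM -(expr0 zeta) (eq_prim_root_expr zprim) !modn_small //; lia.
Qed.

(** The irreducible representations have to be functions of the maps themselves,
    which requires an inverse of [g]. *)
Lemma exists_coord : exists coord : ('rV[R[i]]_d -> 'rV[R[i]]_d) -> R[i] * bool,
  forall x, x \in G -> coord (g x) = x.
Proof.
suff /choice [coord hc] : forall f, exists x, forall y, y \in G -> f = g y -> x = y.
  by exists coord => x xG; exact: hc xG erefl.
move=> f; have [[y [yG fy]]|no] := pselect (exists y, y \in G /\ f = g y).
  by exists y => y' yG'; rewrite fy; apply: g_inj.
by exists (1, false) => y yG fy; case: no; exists y.
Qed.

Let q := p.-1./2.

Lemma cis_cos t n : cis t ^+ n + (cis t)^-1 ^+ n = real_complex R (2 * cos (n%:R * t)).
Proof.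
rewrite cisV !cisX mulrN /cis cosN sinN; apply/eqP.
by rewrite eq_complex /= subrr eqxx andbT mulr2n mulrDl mul1r.
Qed.

(** The classes: a rotation by [2 k pi / p] comes from [u = cis (2 k pi / p)] or its
    inverse, only [u = 1] gives the identity, and an element of order two is a
    reflection because [p] is odd. *)
Lemma dihedral_irreps_dihedral_irr coord : (forall x, x \in G -> coord (g x) = x) ->
  dihedral_irreps lam (fun (j : 'I_((p + 3)./2)) f => dihedral_irr p j.+1 (coord f)).
Proof.
move=> cE j; split; first split.
- split; first by rewrite -g1 cE ?one_elt // dihedral_irr1.
  move=> f1 f2 /stabP [x xG ->] /stabP [y yG ->].
  by rewrite -g_mul // !cE ?dihedral_mul_elt // dihedral_irrM.
- by rewrite /irr_dim; case: ifP.
- move=> U UX; apply: (dihedral_irr_irreducible p_odd p_ge3 zprim) => // x xG.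
  by have := UX _ (g_stab xG); rewrite cE.
move=> k f /andP[k1 kp] fK; have [/stabP [x xG fE] _] := fK.
rewrite fE in fK *; rewrite cE // /irr_char -/q.
have up : x.1 ^+ p = 1 by apply/eqP; move: xG; rewrite unfold_in.
have Nq : (p + 3)./2 = q.+2 by rewrite /q; lia.
have Sq : p.+1./2 = q.+1 by rewrite /q; lia.
have jN : (j.+1 <= q.+2)%N by rewrite -Nq.
have l0 : (0 < j.+1)%N by [].
move: (j.+1) l0 jN => {j} l l0 jN.
rewrite Sq; rewrite Nq in kp *.
case: (leqP k q) => kq.
  have [] := Kclass_rot xG _ fK; first by rewrite k1.
  case: x xG fE fK up => u b xG fE fK up /= -> uw.
  rewrite trace_dihedral_irr_rot -/q; case: (leqP l q) => lq.
    have key (w : R[i]) : u = w \/ u = w^-1 -> u ^+ l + u^-1 ^+ l = w ^+ l + w^-1 ^+ l.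
      by move=> [] ->; [|rewrite invrK addrC].
    rewrite (key _ uw).
    rewrite cis_cos; congr (real_complex R (2 * cos _)); ring.
  by case: eqP => //; case: eqP => //; lia.
have k2 : (k == q.+1) || (k == q.+2) by lia.
case/orP: k2 => /eqP kE.
  have x1 : x = (1, false).
    apply: g_inj => //; first exact: one_elt.
    by move: fK => [_]; rewrite -/q leqNgt kq Sq kE eqxx g1.
  rewrite x1 dihedral_irr1 mxtrace1 kE eqxx /irr_dim -/q.
  case: (leqP l q) => lq; first exact: esym (rmorph_nat (real_complex R) 2).
  by case: eqP => //; case: eqP => //; lia.
have kq1 : (k == q.+1) = false by rewrite kE; lia.
have x2 : x.2 = true.
  move: fK => [_]; rewrite -/q leqNgt kq Sq kq1 => -[gx1 gx2].
  apply/negP => /negP/negbTE x2; apply: gx1; rewrite -g1; congr g.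
  have := gx2; rewrite -g_mul // -g1 => /(g_inj (dihedral_mul_elt xG xG) (one_elt _)).
  rewrite /dihedral_mul x2 => -[]; rewrite -expr2 => x12.
  case: x x2 up x12 {fE xG gx2} => u b /= -> up u2; congr (_, _).
  have pE : p = (2 * q + 1)%N by rewrite /q; lia.
  by rewrite -up pE exprD exprM u2 expr1n mul1r.
case: x x2 {fE fK xG up} => u b /= ->.
rewrite trace_dihedral_irr_refl -/q kq1 kE eqxx.
case: (leqP l q) => lq //; case: (l == q.+1) => //.
exact: esym (rmorphN1 (real_complex R)).
Qed.

(** The dimensions match because [3 + d = 2 * delta + p * size L]. *)
Lemma sum_dims (a : seq nat) :
  (forall l, (0 < l <= q)%N -> nth 0%N a l.-1 + (l == 1) = size L + delta * (l == 1))%N ->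
  (2 * nth 0 a q + (1%R \in L) + (-1 \in L)%R = size L)%N ->
  (2 * nth 0 a q.+1 + 2 = size L + (1%R \in L) + (-1 \in L)%R)%N ->
  d = (\sum_(j < (p + 3)./2) \sum_(i < nth 0%N a j) irr_dim p j.+1)%N.
Proof.
move=> ha hb hc; have -> : (p + 3)./2 = q.+2 by rewrite /q; lia.
under eq_bigr do rewrite sum_nat_const card_ord.
rewrite !big_ord_recr /= /irr_dim -/q ltnn [(q.+1 < q)%N]ltnNge leqnSn /=.
have -> : (\sum_(j < q) nth 0 a j * (if (j < q)%N then 2%R else 1%R) =
  2 * \sum_(j < q) nth 0 a j)%N.
  by rewrite big_distrr /=; apply: eq_bigr => j _; rewrite ltn_ord mulnC.
have q0 : (0 < q)%N by rewrite /q; lia.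
have s1 : (\sum_(j < q) ((j : nat) == 0) = 1)%N.
  by rewrite (bigD1 (Ordinal q0)) //= big1 ?addn0 // => j; rewrite -val_eqE /= => /negPf ->.
have : (\sum_(j < q) nth 0 a j + 1 = q * size L + delta)%N.
  rewrite -{1}s1 -big_split /=.
  transitivity (\sum_(j < q) (size L + delta * ((j : nat) == 0)))%N.
    by apply: eq_bigr => j _; have := ha j.+1; rewrite ltn_ord /= eqSS; apply.
  by rewrite big_split /= -big_distrr /= s1 muln1 sum_nat_const card_ord.
have := card_root_config p_odd kl lh hm sL; have pE : p = (2 * q + 1)%N by rewrite /q; lia.
move: (\sum_(j < q) nth 0%N a j)%N => S.
have ps : (p * size L = 2 * (q * size L) + size L)%N by rewrite pE mulnDl mul1n mulnA.
rewrite ps; move: (q * size L)%N (size L) hb hc => qs s hb hc h1 h2.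
rewrite !muln1; lia.
Qed.

(** The hypotheses are the multiplicities given by the traces, written over natural
    numbers without subtraction or division. *)
Lemma multiplicity_vector_traces (a : seq nat) : size a = q.+2 ->
  (forall l, (0 < l <= q)%N -> nth 0%N a l.-1 + (l == 1) = size L + delta * (l == 1))%N ->
  (2 * nth 0 a q + (1%R \in L) + (-1 \in L)%R = size L)%N ->
  (2 * nth 0 a q.+1 + 2 = size L + (1%R \in L) + (-1 \in L)%R)%N ->
  multiplicity_vector p lam a.
Proof.
move=> sa ha hb hc; have Nq : (p + 3)./2 = q.+2 by rewrite /q; lia.
split; first by rewrite Nq.
have [coord cE] := exists_coord.
exists (fun j f => dihedral_irr p j.+1 (coord f)); split; first exact: dihedral_irreps_dihedral_irr.
pose t : R[i] := 1 - (1 \in L)%:R - (-1 \in L)%:R.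
have [|B [Bf BX]] := dihedral_decomposition p_odd p_ge3 zprim stab_rep1 stab_repM
  trace_stab_rep_rot trace_stab_rep_refl (a := a).
  move=> l /andP[l0 lq]; rewrite -/q.
  case: ifP => lq'.
    have := congr1 (fun n => n%:R : R[i]) (ha l _); rewrite l0 lq' => /(_ isT).
    rewrite !natrD natrM => /eqP; rewrite -subr_eq0 => /eqP h0.
    apply/eqP; rewrite -subr_eq0 -h0; apply/eqP; ring.
  have lE : (l == q.+1) || (l == q.+2) by lia.
  case/orP: lE => /eqP ->; rewrite /refl_sign -/q.
    have <- : 2 * (nth 0%N a q)%:R + (1 \in L)%:R + (-1 \in L)%:R = (size L)%:R :> R[i].
      by rewrite -natrM -!natrD hb.
    by rewrite eqxx; field.
  have h0 : 2 * (nth 0%N a q.+1)%:R + 2 = (size L)%:R + (1 \in L)%:R + (-1 \in L)%:R :> R[i].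
    by rewrite -natrM -!natrD hc.
  have -> : (q.+2 == q.+1) = false by lia.
  have -> : (size L)%:R = 2 * (nth 0%N a q.+1)%:R + 2 - (1 \in L)%:R - (-1 \in L)%:R :> R[i].
    by rewrite h0; ring.
  by field.
have dE : d = (\sum_(j < (p + 3)./2) \sum_(i < nth 0%N a j) irr_dim p j.+1)%N.
  exact: sum_dims.
exists B; split; first exact: dE.
  by rewrite /row_free -mxrank_tr (eqP Bf); apply/eqP; exact: esym dE.
move=> f /stabP [x xG ->]; rewrite (cE x xG); exact: BX.
Qed.
End Action.

(** * The multiplicity vectors *)

Section Types.
Variables (R : realType) (d p : nat) (lam : 'rV[R[i]]_d).
Hypotheses (p_odd : odd p) (p_ge3 : (3 <= p)%N) (d_ge2 : (2 <= d)%N) (kl : Kn lam).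
Hypothesis dih : stab_dihedral p lam.
Local Open Scope classical_set_scope.

(** The case analysis by types is thereby reduced to arithmetic: [l0] contains 1 for
    [A_p] and -1 for [B_p], and [delta] tells whether 0 and infinity are present. *)
Lemma of_form_multiplicity m (S0 : set (sphere R)) l0 (delta : bool) (x y b c : nat) :
  S0 = root_config p delta l0 -> uniq l0 -> {subset l0 <= [:: 1; -1]} ->
  of_form p m S0 lam ->
  (x + 1 = size l0 + 2 * m + delta)%N -> (y = size l0 + 2 * m)%N ->
  (2 * b + (1%R \in l0) + (-1 \in l0)%R = size l0 + 2 * m)%N ->
  (2 * c + 2 = size l0 + 2 * m + (1%R \in l0) + (-1 \in l0)%R)%N ->
  multiplicity_vector p lam (x :: nseq (p - 3)./2 y ++ [:: b; c]).
Proof.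
move=> S0E ul0 l0s hS xE yE bE cE.
have sl0 : symmetric_roots l0.
  split=> //.
    by apply/negP => /l0s; rewrite !inE eq_sym oner_eq0 eq_sym oppr_eq0 oner_eq0.
  by move=> u ul; have := l0s _ ul; rewrite !inE => /orP[] /eqP uE; move: ul;
    rewrite uE ?invrN invr1.
have [h [L [lh hm sL szL [L1 LN1]]]] := of_form_root_config p_odd S0E sl0 l0s hS.
have [sigma sP] := exists_sigma p_odd kl lh hm sL.
have qE : p.-1./2 = (p - 3)./2.+1 by lia.
apply: (multiplicity_vector_traces p_odd p_ge3 d_ge2 kl lh hm sL dih sP);
  rewrite ?szL ?L1 ?LN1 qE.
- by rewrite /= size_cat size_nseq /= addn2.
- move=> l lq; case: l lq => [|[|l]] // lq; first by rewrite /= muln1.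
  rewrite /= nth_cat size_nseq nth_nseq muln0 !addn0 yE.
  by have -> : (l < (p - 3)./2)%N by lia.
- by rewrite /= nth_cat size_nseq ltnn subnn.
- by rewrite /= nth_cat size_nseq ltnNge leqnSn /= subSnn.
Qed.
End Types.

Theorem theorem19 (R : realType) (n p : nat) (lam : 'rV[R[i]]_(n - 3)) :
  (5 <= n)%N -> (3 <= p)%N -> odd p ->
  Kn lam -> stab_dihedral p lam ->
  (forall m, type_mC p m lam ->
     (p = 3%N -> multiplicity_vector p lam [:: (2 * m - 1)%N; m; (m - 1)%N]) /\
     ((5 <= p)%N -> multiplicity_vector p lam
        ((2 * m - 1)%N :: nseq ((p - 3)./2) (2 * m)%N ++ [:: m; (m - 1)%N]))) /\
  (forall m, type_A_mC p m lam ->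
     (p = 3%N -> multiplicity_vector p lam [:: (2 * m)%N; m; m]) /\
     ((5 <= p)%N -> multiplicity_vector p lam
        ((2 * m)%N :: nseq ((p - 3)./2) (2 * m + 1)%N ++ [:: m; m]))) /\
  (forall m, type_AB_mC p m lam ->
     (p = 3%N -> multiplicity_vector p lam [:: (2 * m + 1)%N; m; (m + 1)%N]) /\
     ((5 <= p)%N -> multiplicity_vector p lam
        ((2 * m + 1)%N :: nseq ((p - 3)./2) (2 * m + 2)%N ++ [:: m; (m + 1)%N]))) /\
  (forall m, type_2_mC p m lam ->
     multiplicity_vector p lam
       (nseq ((p - 1)./2) (2 * m)%N ++ [:: m; (m - 1)%N])) /\
  (forall m, type_A_2_mC p m lam ->
     multiplicity_vector p lam
       (nseq ((p - 1)./2) (2 * m + 1)%N ++ [:: m; m])) /\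
  (forall m, type_AB_2_mC p m lam ->
     multiplicity_vector p lam
       (nseq ((p - 1)./2) (2 * m + 2)%N ++ [:: m; (m + 1)%N])).
Proof.
move=> n5 p3 p_odd kl dih; have d2 : (2 <= n - 3)%N by lia.
have main := of_form_multiplicity p_odd p3 d2 kl dih.
have qE : (p - 1)./2 = (p - 3)./2.+1 by lia.
have N11 : (-1 == 1 :> R[i]) = false by rewrite eq_sym -subr_eq0 opprK -mulr2n pnatr_eq0.
(* For p = 3 the middle block is empty. *)
have both x y b c : multiplicity_vector p lam (x :: nseq (p - 3)./2 y ++ [:: b; c]) ->
    (p = 3%N -> multiplicity_vector p lam [:: x; b; c]) /\
    ((5 <= p)%N -> multiplicity_vector p lam (x :: nseq (p - 3)./2 y ++ [:: b; c])).
  by move=> H; split=> // pE; move: H; rewrite {2}pE.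
have AB : (Aset p `|` Bset p = root_config p false [:: 1;
  -1] :> classical_sets.set (sphere R))%classic.
  by rewrite Aset_root_config // Bset_root_config // root_configU.
have with_poles l (S : classical_sets.set (sphere R)) : S = root_config p false l ->
    (S `|` @poles R = root_config p true l)%classic.
  by move=> ->; rewrite classical_sets.setUC -(root_config_polesU p true l).
have set0E : classical_sets.set0 = root_config p false [::] :> classical_sets.set (sphere R).
  by apply/classical_sets.seteqP; split=> // -[x|] //=; case: eqP.
have N11' : (1 == -1 :> R[i]) = false by rewrite eq_sym.
split; [|split; [|split; [|split; [|split]]]].
- move=> m [m1 hm]; apply: both.
  by apply: (main m _ [::] false _ _ _ _ _ _ _ hm) => //=; lia.
- move=> m hm; apply: both.
  by apply: (main m _ [:: 1] false _ _ _ _ _ _ _ hm) => //=;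
    rewrite ?Aset_root_config // ?inE ?eqxx ?N11; try lia; move=> u; rewrite !inE => ->.
- move=> m [m1 hm]; apply: both.
  by apply: (main m _ [:: 1; -1] false _ _ _ _ _ _ _ hm) => //=;
    rewrite ?AB // ?inE ?eqxx ?N11 ?N11' /=; lia.
- move=> m [m1 hm]; rewrite qE.
  by apply: (main m _ [::] true _ _ _ _ _ _ _ hm) => //=; first [exact: poles_root_config | lia].
- move=> m hm; rewrite qE.
  by apply: (main m _ [:: 1] true _ _ _ _ _ _ _ hm) => //=;
    rewrite ?(with_poles [:: 1]) ?Aset_root_config // ?inE ?eqxx ?N11; try lia; move=> u;
      rewrite !inE => ->.
- move=> m [m1 hm]; rewrite qE.
  by apply: (main m _ [:: 1; -1] true _ _ _ _ _ _ _ hm) => //=;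
    rewrite ?(with_poles [:: 1; -1]) ?AB // ?inE ?eqxx ?N11 ?N11' /=; lia.
Qed.
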